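(* The following conditions on a group $G$ are equivalent: (i) $G$ is locally finite. (ii) $\mathrm{Ghd}_k G=0$ for every commutative ring $k$. (iii) $\mathrm{Ghd}_{\mathbb{Z}}G=0$.
   Context: Rings are associative and unital; modules are left modules unless otherwise specified. A group is locally finite if each of its finitely generated subgroups is finite. An acyclic (i.e. exact, unbounded) complex $\mathbf{F}$ of flat $R$-modules is a complete flat resolution if $I\otimes_R\mathbf{F}$ is acyclic for every injective right $R$-module $I$; a module is Gorenstein flat if it is a syzygy of a complete flat resolution. The Gorenstein flat dimension $\mathrm{Gfd}_R M$ is the length of a shortest resolution of $M$ by Gorenstein flat modules ($\infty$ if there is none of finite length). For a commutative ring $k$ and a group $G$, $\mathrm{Ghd}_kG=\mathrm{Gfd}_{kG}k$, where $k$ is the trivial $kG$-module. *)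

(* Defs.v *)
From HB Require Import structures.
From mathcomp Require Import all_boot all_algebra.
From mathcomp Require Import finmap.
From mathcomp Require Import boolp classical_sets cardinality.
From mathcomp Require Import multinomials.monalg.

Set Implicit Arguments.
Unset Strict Implicit.
Unset Printing Implicit Defensive.

Import GRing.Theory.
Local Open Scope ring_scope.

(* Conventions: rings are [pzRingType], so the zero ring is allowed; a left
   R-module is an [lmodType R], a right R-module is an [lmodType R^c] over the
   converse ring, the right action v.r being [(r : R^c) *: v]. *)

Definition is_subgroup (G : groupType) (H : set G) : Prop :=
  [/\ H 1%g, forall x y, H x -> H y -> H (x * y)%g & forall x, H x -> H x^-1%g].

Definition locally_finite (G : groupType) : Prop :=
  forall A : set G, finite_set A -> finite_set (smallest (@is_subgroup G) A).

(* MathComp's ring structure on [{malg k[G]}] requires a monoid without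
   nontrivial units, so groups need their own convolution product. *)
Definition group_ring (k : pzRingType) (G : groupType) : Type := {malg k[G]}.

Section GroupRing.
Variables (k : pzRingType) (G : groupType).
Local Notation kG := {malg k[G]}.
Implicit Types f g h : kG.

Definition group_ring_one : kG := mkmalgU 1%g 1.

Definition group_ring_mul f g : kG :=
  \sum_(x <- msupp f) \sum_(y <- msupp g) mkmalgU (x * y)%g (f@_x * g@_y).

Local Notation mul := group_ring_mul.

Let mulw (d1 d2 : {fset G}) f g :
  (msupp f `<=` d1)%fset -> (msupp g `<=` d2)%fset ->
  mul f g = \sum_(x <- d1) \sum_(y <- d2) mkmalgU (x * y)%g (f@_x * g@_y).
Proof.
move=> le1 le2; rewrite /mul (big_fset_incl _ le1) /=.
  apply/eq_bigr=> x _; apply/big_fset_incl => // y _ /mcoeff_outdom ->.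
  by rewrite mulr0 monalgU0.
move=> x _ /mcoeff_outdom fx; rewrite big1 // => y _.
by rewrite fx mul0r monalgU0.
Qed.

Let mulUU x y (a b : k) :
  mul (mkmalgU x a) (mkmalgU y b) = mkmalgU (x * y)%g (a * b).
Proof. by rewrite (mulw msuppU_le msuppU_le) !big_seq_fset1 !mcoeffUU. Qed.

Let mulDl : left_distributive mul +%R.
Proof.
move=> f g h; set d := (msupp f `|` msupp g)%fset.
rewrite (@mulw d (msupp h) (f + g) h) ?msuppD_le ?fsubset_refl //.
rewrite (@mulw d (msupp h) f h) ?fsubsetUl ?fsubset_refl //.
rewrite (@mulw d (msupp h) g h) ?fsubsetUr ?fsubset_refl //.
rewrite -big_split; apply/eq_bigr=> x _; rewrite -big_split /=.
by apply/eq_bigr=> y _; rewrite mcoeffD mulrDl monalgUD.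
Qed.

Let mulDr : right_distributive mul +%R.
Proof.
move=> h f g; set d := (msupp f `|` msupp g)%fset.
rewrite (@mulw (msupp h) d h (f + g)) ?msuppD_le ?fsubset_refl //.
rewrite (@mulw (msupp h) d h f) ?fsubsetUl ?fsubset_refl //.
rewrite (@mulw (msupp h) d h g) ?fsubsetUr ?fsubset_refl //.
rewrite -big_split; apply/eq_bigr=> x _; rewrite -big_split /=.
by apply/eq_bigr=> y _; rewrite mcoeffD mulrDr monalgUD.
Qed.

Let mul0 f : mul 0 f = 0.
Proof. by rewrite /mul msupp0 big_seq_fset0. Qed.

Let mulg0 f : mul f 0 = 0.
Proof. by rewrite /mul big1 // => x _; rewrite msupp0 big_seq_fset0. Qed.

Let mul_suml (I : Type) (s : seq I) (F : I -> kG) g :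
  mul (\sum_(i <- s) F i) g = \sum_(i <- s) mul (F i) g.
Proof. exact: (big_morph (mul^~ g) (fun _ _ => mulDl _ _ _) (mul0 g)). Qed.

Let mul_sumr (I : Type) (s : seq I) (F : I -> kG) g :
  mul g (\sum_(i <- s) F i) = \sum_(i <- s) mul g (F i).
Proof. exact: (big_morph (mul g) (fun _ _ => mulDr _ _ _) (mulg0 g)). Qed.

Let mul1 : left_id group_ring_one mul.
Proof.
move=> f; rewrite [in LHS](monalgE f) mul_sumr [RHS]monalgE.
by apply/eq_bigr=> x _; rewrite mulUU mul1g mul1r.
Qed.

Let gmulr1 : right_id group_ring_one mul.
Proof.
move=> f; rewrite [in LHS](monalgE f) mul_suml [RHS]monalgE.
by apply/eq_bigr=> x _; rewrite mulUU mulg1 mulr1.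
Qed.

Let mulA : associative mul.
Proof.
move=> f g h; rewrite (monalgE f) !mul_suml; apply/eq_bigr=> x _.
rewrite (monalgE g) !(mul_suml, mul_sumr); apply/eq_bigr=> y _.
rewrite (monalgE h) !mul_sumr; apply/eq_bigr=> z _.
by rewrite !mulUU mulgA mulrA.
Qed.

HB.instance Definition _ := GRing.Zmodule.on (group_ring k G).
HB.instance Definition _ := GRing.Zmodule_isPzRing.Build (group_ring k G)
  mulA mul1 gmulr1 mulDl mulDr.

End GroupRing.

Definition augmentation (k : pzRingType) (G : groupType) (f : group_ring k G) : k :=
  \sum_(x <- msupp f) f@_x.

Section TrivialModule.
Variables (k : pzRingType) (G : groupType).
Implicit Types f g : group_ring k G.
Local Notation aug := (@augmentation k G).

Let augw (d : {fset G}) f :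
  (msupp f `<=` d)%fset -> aug f = \sum_(x <- d) f@_x.
Proof. by move=> le; apply/big_fset_incl => // x _ /mcoeff_outdom. Qed.

Let augU x (a : k) : aug (mkmalgU x a) = a.
Proof. by rewrite (augw msuppU_le) big_seq_fset1 mcoeffUU. Qed.

Let augD : {morph aug : f g / f + g}.
Proof.
move=> f g; set d := (msupp f `|` msupp g)%fset.
rewrite (@augw d (f + g)) ?msuppD_le // (@augw d f) ?fsubsetUl //.
rewrite (@augw d g) ?fsubsetUr // -big_split.
by apply/eq_bigr=> x _; rewrite mcoeffD.
Qed.

Let aug_sum (I : Type) (s : seq I) (F : I -> group_ring k G) :
  aug (\sum_(i <- s) F i) = \sum_(i <- s) aug (F i).
Proof. by apply: (big_morph aug augD); rewrite /augmentation msupp0 big_seq_fset0. Qed.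

Let augM : {morph aug : f g / f * g}.
Proof.
move=> f g; rewrite [f * g]/(group_ring_mul f g) /group_ring_mul aug_sum mulr_suml.
apply/eq_bigr=> x _; rewrite aug_sum mulr_sumr.
by apply/eq_bigr=> y _; rewrite augU.
Qed.

Let aug1 : aug 1 = 1.
Proof. exact: augU. Qed.

Let augB : zmod_morphism aug.
Proof. by move=> f g; apply: (addIr (aug g)); rewrite -augD !subrK. Qed.

HB.instance Definition _ :=
  GRing.isZmodMorphism.Build (group_ring k G) k aug augB.
HB.instance Definition _ := GRing.isMonoidMorphism.Build (group_ring k G) k aug
  (aug1, augM).

End TrivialModule.

(* Every g in G acts as the identity, i.e. kG acts through the augmentation. *)
Definition trivial_module (k : pzRingType) (G : groupType) : Type := k.

Section TrivialModuleStructure.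
Variables (k : pzRingType) (G : groupType).
Local Notation T := (trivial_module k G).

HB.instance Definition _ := GRing.Zmodule.on T.

Let scale (f : group_ring k G) (x : T) : T := augmentation f * (x : k).

Let scaleA f g x : scale f (scale g x) = scale (f * g) x.
Proof. by rewrite /scale rmorphM mulrA. Qed.

Let scale1 : left_id 1 scale.
Proof. by move=> x; rewrite /scale rmorph1 mul1r. Qed.

Let scaleDr : right_distributive scale +%R.
Proof. by move=> f x y; rewrite /scale mulrDr. Qed.

Let scaleDl x : {morph scale^~ x : f g / f + g}.
Proof. by move=> f g; rewrite /scale raddfD mulrDl. Qed.

HB.instance Definition _ := GRing.Zmodule_isLmodule.Build (group_ring k G) T
  scaleA scale1 scaleDr scaleDl.

End TrivialModuleStructure.

Section Tensor.
Variables (R : pzRingType) (A : lmodType R^c) (M : lmodType R).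

(* The formal sums that have to vanish in the tensor product lie in S. *)
Definition contains_tensor_relations (S : {pred {malg (A * M)%type}}) : Prop :=
  [/\ forall a a' m, << (a + a', m) >> - << (a, m) >> - << (a', m) >> \in S,
      forall a m m', << (a, m + m') >> - << (a, m) >> - << (a, m') >> \in S &
      forall a (r : R) m, << ((r : R^c) *: a, m) >> - << (a, r *: m) >> \in S].

Definition tensor_null : {pred {malg (A * M)%type}} := fun t =>
  `[< forall S, zmod_closed S -> contains_tensor_relations S -> t \in S >].

Let tensor_null_zmod_closed : zmod_closed tensor_null.
Proof.
split=> [|s t /asboolP s0 /asboolP t0]; apply/asboolP => S clS relS.
  by case: clS.
by case: (clS) => _; apply; [apply: s0|apply: t0].
Qed.

HB.instance Definition _ :=
  GRing.isZmodClosed.Build {malg (A * M)%type} tensor_null tensor_null_zmod_closed.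

(* A (x)_R M, the quotient of the free abelian group on A x M. *)
Definition tensor : zmodType := {ideal_quot tensor_null}.

Definition tens (a : A) (m : M) : tensor := (\pi << (a, m) >>)%qT.

(* The homomorphism a (x) m |-> b a m; meaningful when b is balanced. *)
Definition tensor_lift (Z : zmodType) (b : A -> M -> Z) (t : tensor) : Z :=
  let s := repr t in \sum_(p <- msupp s) b p.1 p.2 *~ s@_p.

End Tensor.

Section TensorTheory.
Variables (R : pzRingType) (A : lmodType R^c) (M : lmodType R).

Lemma tensDl a a' m : tens (a + a') m = tens a m + tens a' m :> tensor A M.
Proof.
apply/eqP; rewrite -subr_eq0 opprD addrA /tens -!raddfB /=.
rewrite -(raddf0 \pi_(tensor A M)%qT) -Quotient.idealrBE subr0.
by apply/asboolP => S _ [+ _ _]; apply.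
Qed.

Lemma tensDr a m m' : tens a (m + m') = tens a m + tens a m' :> tensor A M.
Proof.
apply/eqP; rewrite -subr_eq0 opprD addrA /tens -!raddfB /=.
rewrite -(raddf0 \pi_(tensor A M)%qT) -Quotient.idealrBE subr0.
by apply/asboolP => S _ [_ + _]; apply.
Qed.

Lemma tensZ a (r : R) m :
  tens ((r : R^c) *: a) m = tens a (r *: m) :> tensor A M.
Proof.
apply/eqP; rewrite -subr_eq0 /tens -!raddfB /=.
rewrite -(raddf0 \pi_(tensor A M)%qT) -Quotient.idealrBE subr0.
by apply/asboolP => S _ [_ _ +]; apply.
Qed.

Definition balanced (Z : zmodType) (b : A -> M -> Z) : Prop :=
  [/\ forall a a' m, b (a + a') m = b a m + b a' m,
      forall a m m', b a (m + m') = b a m + b a m' &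
      forall a (r : R) m, b ((r : R^c) *: a) m = b a (r *: m)].

Section Lift.
Variables (Z : zmodType) (b : A -> M -> Z).
Hypothesis bal : balanced b.

Let L (s : {malg (A * M)%type}) : Z := \sum_(p <- msupp s) b p.1 p.2 *~ s@_p.

Let Lw d s : (msupp s `<=` d)%fset -> L s = \sum_(p <- d) b p.1 p.2 *~ s@_p.
Proof.
by move=> le; apply/big_fset_incl => // p _ /mcoeff_outdom ->; rewrite mulr0z.
Qed.

Let LB : zmod_morphism L.
Proof.
move=> s t; set d := (msupp s `|` msupp t)%fset.
rewrite (@Lw d (s - t)) ?msuppB_le // (@Lw d s) ?fsubsetUl //.
rewrite (@Lw d t) ?fsubsetUr // -sumrB.
by apply/eq_bigr=> p _; rewrite mcoeffB mulrzBr.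
Qed.

Let LU a m : L << (a, m) >> = b a m.
Proof. by rewrite (Lw msuppU_le) big_seq_fset1 mcoeffUU mulr1z. Qed.

Let L_null s : s \in @tensor_null R A M -> L s = 0.
Proof.
have [bDl bDr bZ] := bal.
move=> /asboolP /(_ [pred s | L s == 0]); rewrite inE => H; apply/eqP/H.
  split=> [|u v]; rewrite !inE; first by rewrite /L msupp0 big_seq_fset0.
  by move=> /eqP u0 /eqP v0; rewrite LB u0 v0 subrr.
by split=> *; rewrite inE !LB !LU ?(bDl, bDr, bZ) ?subrr // -addrA -opprD subrr.
Qed.

Let lift_pi s : tensor_lift b (\pi s)%qT = L s.
Proof.
apply/eqP; rewrite -subr_eq0 -LB L_null //.
by rewrite Quotient.idealrBE reprK.
Qed.

Lemma tensor_liftE a m : tensor_lift b (tens a m) = b a m.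
Proof. by rewrite lift_pi LU. Qed.

Lemma tensor_lift_zmod_morphism : zmod_morphism (@tensor_lift R A M Z b).
Proof.
by move=> s t; rewrite -[s]reprK -[t]reprK -raddfB !lift_pi LB.
Qed.

End Lift.
End TensorTheory.

Definition tensor_map (R : pzRingType) (A B : lmodType R^c) (M N : lmodType R)
    (f : {linear A -> B}) (g : {linear M -> N}) : tensor A M -> tensor B N :=
  tensor_lift (fun a m => tens (f a) (g m)).

Section TensorMapTheory.
Variables (R : pzRingType) (A B : lmodType R^c) (M N : lmodType R).
Variables (f : {linear A -> B}) (g : {linear M -> N}).

Let bal : balanced (fun a m => tens (f a) (g m)).
Proof.
split=> [a a' m|a m m'|a r m]; first by rewrite raddfD tensDl.
  by rewrite raddfD tensDr.
by rewrite !linearZ tensZ.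
Qed.

Lemma tensor_mapE a m : tensor_map f g (tens a m) = tens (f a) (g m).
Proof. exact: (tensor_liftE bal). Qed.

HB.instance Definition _ := GRing.isZmodMorphism.Build (tensor A M) (tensor B N)
  (tensor_map f g) (tensor_lift_zmod_morphism bal).

End TensorMapTheory.

Definition exact (A B C : zmodType) (f : A -> B) (g : B -> C) : Prop :=
  forall y, g y = 0 <-> exists x, f x = y.

Section GorensteinFlat.
Variable R : pzRingType.

Definition flat (M : lmodType R) : Prop :=
  forall (A B : lmodType R^c) (f : {linear A -> B}),
    injective f -> injective (tensor_map f (idfun : {linear M -> M})).

(* Homological indexing: the differential F_(i+1) -> F_i has index i. *)
Record complex := Complex {
  term :> int -> lmodType R;
  diff : forall i, {linear term (1 + i) -> term i};
  diffK : forall i x, diff i (diff (1 + i) x) = 0 }.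

Definition acyclic (F : complex) : Prop :=
  forall i, exact (diff F (1 + i)) (diff F i).

Definition tensor_acyclic (I : lmodType R^c) (F : complex) : Prop :=
  forall i, exact (tensor_map (idfun : {linear I -> I}) (diff F (1 + i)))
                  (tensor_map (idfun : {linear I -> I}) (diff F i)).

End GorensteinFlat.

Definition injective_module (S : pzRingType) (I : lmodType S) : Prop :=
  forall (A B : lmodType S) (f : {linear A -> B}) (g : {linear A -> I}),
    injective f -> exists h : {linear B -> I}, forall x, h (f x) = g x.

Definition complete_flat_resolution (R : pzRingType) (F : complex R) : Prop :=
  [/\ forall i, flat (F i), acyclic F &
      forall I : lmodType R^c, injective_module I -> tensor_acyclic I F].

(* M is isomorphic to the kernel of some differential. *)
Definition syzygy (R : pzRingType) (F : complex R) (M : lmodType R) : Prop :=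
  exists (i : int) (f : {linear M -> F (1 + i)}),
    injective f /\ exact f (diff F i).

Definition Gorenstein_flat (R : pzRingType) (M : lmodType R) : Prop :=
  exists F : complex R, complete_flat_resolution F /\ syzygy F M.

(* There is an exact sequence 0 -> P_n -> ... -> P_0 -> M -> 0 with all P_i
   Gorenstein flat; it is extended by P_i = 0 for i > n. *)
Definition Gorenstein_flat_resolution (R : pzRingType) (M : lmodType R)
    (n : nat) : Prop :=
  exists (P : nat -> lmodType R) (d : forall i, {linear P i.+1 -> P i})
         (e : {linear P 0%N -> M}),
    [/\ forall i, Gorenstein_flat (P i),
        forall i, (n < i)%N -> forall x : P i, x = 0,
        forall y, exists x, e x = y,
        exact (d 0%N) e &
        forall i, exact (d i.+1) (d i)].

(* [None] stands for infinity. *)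
Definition Gfd (R : pzRingType) (M : lmodType R) : option nat :=
  if pselect (exists n, `[< Gorenstein_flat_resolution M n >]) is left ex
  then Some (ex_minn ex) else None.

Definition Ghd (k : comPzRingType) (G : groupType) : option nat :=
  Gfd (trivial_module k G : lmodType (group_ring k G)).

(* Main.v *)
From HB Require Import structures.
From mathcomp Require Import all_boot all_algebra.
From mathcomp Require Import finmap.
From mathcomp Require Import boolp classical_sets functions cardinality.
From mathcomp Require Import multinomials.monalg.
Require Import Defs.

Set Implicit Arguments.
Unset Strict Implicit.
Unset Printing Implicit Defensive.

Import GRing.Theory.
Local Open Scope ring_scope.

(** The Gorenstein flat dimension of k vanishes exactly when k itself is a
Gorenstein flat kG-module, because a resolution of length 0 is an isomorphism.

If k = Z is Gorenstein flat, it embeds in a flat module F, and the image m of 1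
is a nonzero element fixed by G.  Let x_1, ..., x_n be elements of G.  If the
right linear map kG -> (kG)^n sending r to ((x_i - 1) r)_i were injective, it
would remain so after tensoring with F; but it sends 1 (x) m to
sum_i e_i (x) (x_i - 1) m = 0, which would give m = 0.  So some r != 0 in kG
satisfies x_i r = r for all i.  The finite nonempty support of r is then stable
under the subgroup generated by the x_i, which is therefore finite.

If G is locally finite, a complete flat resolution of k is written down: the
homogeneous bar resolution, with n-chains the free module on G^(n+1), is
spliced at k with a homogeneous cochain complex whose n-cochains are the
functions G^(n+1) -> k taking finitely many values.  The finiteness makes these
cochains flat over every commutative ring k, which arbitrary functions need not
be.  Two facts about tensor products over kG carry the argument, and both rest
on [tensor_null_finite]: an element that vanishes in a tensor product over kG
already vanishes over kF for a finite subgroup F.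

- Flatness ([function_module_flat]).  For F finite acting freely on Y, finitely
  many finite-valued functions on Y can be written at once over the indicator
  functions of the blocks of one finite partition of a fundamental domain.  This
  makes an element of A (x) M computable from finitely many elements of A, in a
  way that is natural in A.
- Acyclicity after tensoring with an injective right module I
  ([contraction_tensor_exact]).  The embedding of I in the coinduced module
  Hom_Z(kG, I) splits, and a retraction yields a k-linear endomorphism psi of I
  with sum_(f in F) psi(i f) f^-1 = i ([injective_trace]).  A k-linear
  contracting homotopy s of a complex of kG-modules can then be averaged to
  i (x) x |-> sum_f psi(i f) (x) s(f^-1 x), which contracts I (x)_kF X.  The
  spliced complex has such a homotopy s: insert the coordinate 1 into chains and
  evaluate cochains at the coordinate 1. *)

(** * Additive maps out of free abelian groups and tensor products *)

Section MalgLift.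
Variables (K : choiceType) (k Z : zmodType).

Lemma malg_ind (P : {malg k[K]} -> Prop) :
  P 0 -> (forall c c', P c -> P c' -> P (c + c')) ->
  (forall x a, P (mkmalgU x a)) -> forall c, P c.
Proof. by move=> P0 PD PU c; rewrite (monalgE c); apply: (big_ind P). Qed.

Definition malg_lift (h : K -> {additive k -> Z}) (c : {malg k[K]}) : Z :=
  \sum_(x <- msupp c) h x c@_x.

Lemma malg_liftw (h : K -> {additive k -> Z}) (d : {fset K}) c :
  (msupp c `<=` d)%fset -> malg_lift h c = \sum_(x <- d) h x c@_x.
Proof.
by move=> le; apply/big_fset_incl => // x _ /mcoeff_outdom ->; rewrite raddf0.
Qed.

Lemma malg_liftU (h : K -> {additive k -> Z}) x a :
  malg_lift h (mkmalgU x a) = h x a.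
Proof. by rewrite (malg_liftw _ msuppU_le) big_seq_fset1 mcoeffUU. Qed.

Lemma malg_lift_zmod_morphism (h : K -> {additive k -> Z}) :
  zmod_morphism (malg_lift h).
Proof.
move=> c c'; set d := (msupp c `|` msupp c')%fset.
rewrite (@malg_liftw h d (c - c')) ?msuppB_le // (@malg_liftw h d c) ?fsubsetUl //.
rewrite (@malg_liftw h d c') ?fsubsetUr // -sumrB.
by apply/eq_bigr=> x _; rewrite mcoeffB raddfB.
Qed.

HB.instance Definition _ h :=
  GRing.isZmodMorphism.Build {malg k[K]} Z (malg_lift h)
    (malg_lift_zmod_morphism h).

End MalgLift.

Section TensorElements.
Variables (R : pzRingType) (A : lmodType R^c) (M : lmodType R).

(** The extension of [b] to the free abelian group on [A * M].  Balancedness is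
not required, so that one formal sum can be evaluated under maps that are
balanced over different subrings of [R]. *)
Definition fsum (Z : zmodType) (b : A -> M -> Z) : {malg (A * M)%type} -> Z :=
  malg_lift (fun p => *~%R (b p.1 p.2)).

HB.instance Definition _ (Z : zmodType) (b : A -> M -> Z) :=
  GRing.Additive.on (fsum b).

Lemma fsumU (Z : zmodType) (b : A -> M -> Z) a m : fsum b << (a, m) >> = b a m.
Proof. by rewrite /fsum malg_liftU /= mulr1z. Qed.

Lemma raddf_fsum (Z Z' : zmodType) (h : {additive Z -> Z'}) (b : A -> M -> Z) u :
  h (fsum b u) = fsum (fun a m => h (b a m)) u.
Proof. by rewrite raddf_sum; apply/eq_bigr => p _; rewrite raddfMz. Qed.

Lemma eq_fsum (Z : zmodType) (b b' : A -> M -> Z) u :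
  (forall a m, b a m = b' a m) -> fsum b u = fsum b' u.
Proof. by move=> eq_b; apply: eq_bigr => p _; rewrite eq_b. Qed.

Lemma fsumD (Z : zmodType) (b b' : A -> M -> Z) u :
  fsum (fun a m => b a m + b' a m) u = fsum b u + fsum b' u.
Proof.
rewrite /fsum /malg_lift -big_split /=.
by apply: eq_bigr => p _; rewrite /= mulrzDl.
Qed.

Lemma eq_in_fsum (Z : zmodType) (b b' : A -> M -> Z) (u : {malg (A * M)%type}) :
  (forall p, p \in msupp u -> b p.1 p.2 = b' p.1 p.2) -> fsum b u = fsum b' u.
Proof.
by move=> eq_b; apply: eq_big_seq => p pu; rewrite /= eq_b.
Qed.

Lemma fsum0 (Z : zmodType) u : fsum (fun _ _ => 0 : Z) u = 0.
Proof. by rewrite /fsum /malg_lift big1 // => p _; rewrite /= mul0rz. Qed.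

Lemma fsum_sum (Z : zmodType) (T : Type) (s : seq T) (b : T -> A -> M -> Z) u :
  fsum (fun a m => \sum_(t <- s) b t a m) u = \sum_(t <- s) fsum (b t) u.
Proof.
elim: s => [|t s IHs].
  by rewrite big_nil -[RHS](fsum0 Z u); apply: eq_fsum => a m; rewrite big_nil.
by rewrite big_cons -IHs -fsumD; apply: eq_fsum => a m; rewrite big_cons.
Qed.

Lemma tensor_pi (u : {malg (A * M)%type}) :
  (\pi u)%qT = fsum (@tens R A M) u :> tensor A M.
Proof.
rewrite [u in LHS]monalgE raddf_sum; apply: eq_bigr => -[a m] _.
rewrite /= /tens -raddfMz; congr (\pi _)%qT.
apply/malgP => q; rewrite raddfMz /= !mcoeffU.
by case: (_ == q); rewrite ?mul0rz //= mulr1n intz.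
Qed.

Lemma tensor_piP (u : {malg (A * M)%type}) :
  ((\pi u)%qT = 0 :> tensor A M) <-> u \in @tensor_null R A M.
Proof.
rewrite -(raddf0 \pi_(tensor A M)%qT) -[u in X in _ <-> X]subr0.
by rewrite Quotient.idealrBE; split=> [->|/eqP].
Qed.

Lemma tensor_fsum (t : tensor A M) : exists u, t = fsum (@tens R A M) u.
Proof. by exists (repr t); rewrite -tensor_pi reprK. Qed.
End TensorElements.

Section TensorAdditivity.
Variables (R : pzRingType) (M : lmodType R).

Definition tensl (A : lmodType R^c) (m : M) (a : A) : tensor A M := tens a m.

Lemma tensl_zmod_morphism (A : lmodType R^c) (m : M) : zmod_morphism (@tensl A m).
Proof. by move=> a a'; apply: (addIr (tensl m a')); rewrite -tensDl !subrK. Qed.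

HB.instance Definition _ (A : lmodType R^c) (m : M) :=
  GRing.isZmodMorphism.Build A (tensor A M) (@tensl A m) (tensl_zmod_morphism m).

Lemma tens0l (A : lmodType R^c) (m : M) : tens (0 : A) m = 0.
Proof. exact: (raddf0 (tensl m)). Qed.

Lemma tens_suml (A : lmodType R^c) (I : Type) (s : seq I) (P : pred I)
    (F : I -> A) (m : M) :
  tens (\sum_(i <- s | P i) F i) m = \sum_(i <- s | P i) tens (F i) m.
Proof. exact: (raddf_sum (tensl m)). Qed.

Lemma raddf_tensr (A : lmodType R^c) (a : A) : zmod_morphism (@tens R A M a).
Proof. by move=> m m'; apply: (addIr (tens a m')); rewrite -tensDr !subrK. Qed.

HB.instance Definition _ (A : lmodType R^c) (a : A) :=
  GRing.isZmodMorphism.Build M (tensor A M) (@tens R A M a) (raddf_tensr a).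

End TensorAdditivity.

(** * Flat modules and annihilators *)

Section FlatAnnihilator.
Variables (R : pzRingType) (M : lmodType R) (n : nat) (a : 'I_n -> R).

Definition left_mulv (r : R^c^o) : {ffun 'I_n -> R^c^o} :=
  [ffun i => a i * (r : R)].

Lemma left_mulv_linear : linear left_mulv.
Proof.
move=> c r r'; apply/ffunP => i; rewrite !ffunE mulrDr; congr (_ + _).
exact: (mulrA (a i) (r : R) (c : R)).
Qed.

HB.instance Definition _ := GRing.isLinear.Build R^c R^c^o {ffun 'I_n -> R^c^o}
  *:%R left_mulv left_mulv_linear.

(** One direction of the equational criterion of flatness: otherwise left
multiplication by the [a i] embeds [R] in [R^n] as right modules, and flatness
keeps this embedding injective on [R (x) M = M], where it kills [m]. *)
Lemma flat_annihilator (m : M) :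
  flat M -> m <> 0 -> (forall i, a i *: m = 0) ->
  exists2 r, r <> 0 & forall i, a i * r = 0.
Proof.
move=> flatM m_neq0 am0; apply: contrapT => noann; apply: m_neq0.
have inj_a : injective left_mulv.
  move=> r r' /eqP; rewrite -subr_eq0 -raddfB => /eqP ar0; apply/eqP.
  rewrite -subr_eq0; apply/eqP; apply: contrapT => r_neq0; apply: noann.
  by exists (r - r') => // i; move/ffunP/(_ i): ar0; rewrite !ffunE.
pose one : R^c^o := (1 : R).
have t0 : tens one m = 0 :> tensor _ M.
  apply: (flatM _ _ (left_mulv : {linear _ -> _}) inj_a).
  rewrite raddf0 tensor_mapE /=.
  pose e i : {ffun 'I_n -> R^c^o} := [ffun j => if i == j then one else 0].
  have -> : left_mulv one = \sum_i (a i : R^c) *: e i.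
    apply/ffunP => j; rewrite sum_ffunE (bigD1 j) //= !ffunE eqxx big1.
      by rewrite addr0 /one mulr1; exact: (esym (mul1r (a j))).
    by move=> i /negPf ij; rewrite !ffunE ij scaler0.
  rewrite tens_suml big1 //= => i _.
  by rewrite tensZ am0 raddf0.
have bal : @balanced R R^c^o M M (fun r n => (r : R) *: n).
  by split=> [r r' n'|r n' n''|r c n']; rewrite ?scalerDl ?scalerDr ?scalerA.
have := tensor_lift_zmod_morphism bal 0 0; rewrite !subrr -{1}t0 tensor_liftE //.
by rewrite scale1r.
Qed.
End FlatAnnihilator.

(** * Group rings and locally finite groups *)

Section GroupRingTheory.
Variables (k : pzRingType) (G : groupType).
Local Notation kG := (group_ring k G).

Definition gmon (x : G) (a : k) : kG := mkmalgU x a.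

Lemma group_ring_ind (P : kG -> Prop) :
  P 0 -> (forall r r', P r -> P r' -> P (r + r')) ->
  (forall x a, P (gmon x a)) -> forall r, P r.
Proof. exact: malg_ind. Qed.

Lemma gmonM x y a b : gmon x a * gmon y b = gmon (x * y)%g (a * b).
Proof.
rewrite [LHS]/(group_ring_mul _ _) /group_ring_mul.
rewrite (big_fset_incl _ (msuppU_le : (_ `<=` [fset x])%fset)) => [|/= x' _]; last first.
  by move=> /mcoeff_outdom ->; rewrite big1 // => y' _; rewrite mul0r monalgU0.
rewrite big_seq_fset1.
rewrite (big_fset_incl _ (msuppU_le : (_ `<=` [fset y])%fset)) => [|/= y' _]; last first.
  by move=> /mcoeff_outdom ->; rewrite mulr0 monalgU0.
by rewrite big_seq_fset1 !mcoeffUU.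
Qed.

Lemma gmon1 : gmon 1%g 1 = 1.
Proof. by []. Qed.

Lemma gmonDr x a b : gmon x (a + b) = gmon x a + gmon x b.
Proof. exact: monalgUD. Qed.

Lemma mcoeff_gmonM x a (r : kG) y : (gmon x a * r)@_y = a * r@_(x^-1 * y)%g.
Proof.
elim/group_ring_ind: r => [|r r' IHr IHr'|z b].
- by rewrite mulr0 !mcoeff0 mulr0.
- by rewrite mulrDr !mcoeffD mulrDr IHr IHr'.
by rewrite gmonM !mcoeffU -(inj_eq (mulgI x^-1%g)) mulKg mulrnAr.
Qed.

Lemma augmentation_gmon x a : augmentation (gmon x a) = a.
Proof.
rewrite /augmentation (big_fset_incl _ (msuppU_le : (_ `<=` [fset x])%fset)) /=.
  by rewrite big_seq_fset1 mcoeffUU.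
by move=> y _ /mcoeff_outdom.
Qed.

(** A nonzero [r] with [x r = r] for the generators [x] of a subgroup is fixed
by the whole subgroup, which therefore permutes the finite support of [r]
freely. *)
Lemma fixed_vector_locally_finite (M : lmodType kG) (m : M) :
  flat M -> m <> 0 -> (forall x, gmon x 1 *: m = m) -> locally_finite G.
Proof.
move=> flatM m_neq0 fix_m A finA; pose s := fset_set A.
have [i|r r_neq0 ar0] :=
    @flat_annihilator _ _ _ (fun i : 'I_(size s) => gmon (nth 1%g s i) 1 - 1) m flatM m_neq0.
  by rewrite scalerBl fix_m scale1r subrr.
pose H : set G := [set h | gmon h 1 * r = r]%classic.
have subH : is_subgroup H.
  split=> [|x y Hx Hy|x Hx]; rewrite /H /=; first by rewrite gmon1 mul1r.
    by rewrite -[1 in LHS](mulr1 1) -gmonM -mulrA Hy.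
  by rewrite -{1}Hx mulrA gmonM mulVg mulr1 gmon1 mul1r.
have AH : (A `<=` H)%classic.
  move=> x Ax; have xs : x \in s by rewrite in_fset_set // inE.
  have lt_x : (index x s < size s)%N by rewrite index_mem.
  have := ar0 (Ordinal lt_x); rewrite /= nth_index // mulrBl mul1r => /eqP.
  by rewrite subr_eq0 => /eqP.
have [x0 r_x0] : exists x0, x0 \in msupp r.
  apply: contrapT => r0; apply: r_neq0; apply/malgP => y; rewrite mcoeff0.
  by apply: mcoeff_outdom; apply/negP => ry; apply: r0; exists y.
apply: sub_finite_set (smallest_sub subH AH) _.
apply: (@sub_finite_set _ _ ((fun y => y * x0^-1)%g @` [set` msupp r])%classic).
  move=> h Hh; exists (h * x0)%g; last by rewrite mulgK.
  by rewrite /= -mcoeff_neq0 -Hh mcoeff_gmonM mul1r mulKg mcoeff_neq0.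
exact/finite_image/finite_fset.
Qed.
End GroupRingTheory.

Section LocallyFinite.
Variable G : groupType.

Definition finite_subgroup (F : {fset G}) : Prop := is_subgroup [set` F]%classic.

Lemma locally_finite_fset (s : seq G) :
  locally_finite G -> exists2 F, finite_subgroup F & {subset s <= F}.
Proof.
move=> lfG; have finS := lfG _ (finite_seq s).
exists (fset_set (smallest (@is_subgroup G) [set` s]%classic)).
  rewrite /finite_subgroup fset_setK //; split=> [H [[H1 _ _] _] //|x y Hx Hy H|x Hx H].
    by move=> HS; case: (HS) => -[_ HM _] _; exact: (HM _ _ (Hx H HS) (Hy H HS)).
  by move=> HS; case: (HS) => -[_ _ HV] _; exact: (HV _ (Hx H HS)).
by move=> x xs; rewrite in_fset_set // inE => H [_]; apply.
Qed.

Variable F : {fset G}.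
Hypothesis subF : finite_subgroup F.

Lemma fsub1 : 1%g \in F. Proof. by case: subF. Qed.
Lemma fsubM x y : x \in F -> y \in F -> (x * y)%g \in F.
Proof. by case: subF => _ + _; apply. Qed.
Lemma fsubV x : x \in F -> x^-1%g \in F.
Proof. by case: subF => _ _; apply. Qed.
Lemma fsubMl x y : x \in F -> ((x * y)%g \in F) = (y \in F).
Proof.
move=> Fx; apply/idP/idP => [Fxy|]; last exact: fsubM.
by rewrite -(mulKg x y) fsubM // fsubV.
Qed.

Lemma fsub_shift (Z : nmodType) (x : G) (E : G -> Z) : x \in F ->
  \sum_(f <- F) E (x * f)%g = \sum_(f <- F) E f.
Proof.
move=> Fx; rewrite -(big_map (fun f => x * f)%g xpredT); apply: perm_big.
apply: uniq_perm; rewrite ?map_inj_uniq ?fset_uniq //; first exact: mulgI.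
move=> y; apply/mapP/idP => [[f Ff ->]|Fy]; first exact: fsubM.
by exists (x^-1 * y)%g; rewrite ?mulVKg ?fsubM ?fsubV.
Qed.

Definition coset_repr (y : G) : G := choose (fun z => (y * z^-1)%g \in F) y.

(** One element is chosen in each right coset [F y], so that every [y] is
[f * t] for a unique [f] in [F] and a unique [t] in the transversal. *)
Definition transversal : pred G := [pred y | coset_repr y == y].

Lemma coset_reprM f y : f \in F -> coset_repr (f * y)%g = coset_repr y.
Proof.
move=> Ff; rewrite /coset_repr.
rewrite (@eq_choose _ _ (fun z => (y * z^-1)%g \in F)) => [|z /=]; last first.
  by rewrite -mulgA fsubMl.
by apply: choose_id; rewrite /= ?mulgV ?fsub1 // invgM mulVKg fsubV.
Qed.

Lemma coset_reprP y : (y * (coset_repr y)^-1)%g \in F.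
Proof. by apply: (@chooseP _ (fun z => (y * z^-1)%g \in F)); rewrite mulgV fsub1. Qed.

Lemma sum_transversal (Z : nmodType) (y : G) (v : Z) :
  \sum_(f <- F | transversal (f^-1 * y)%g) v = v.
Proof.
pose f0 := (y * (coset_repr y)^-1)%g; rewrite big_seq_cond.
transitivity (\sum_(f <- F | (f \in F) && (f == f0)) v); last first.
  by rewrite -big_seq_cond -big_filter filter_pred1_uniq ?fset_uniq ?coset_reprP ?big_seq1.
apply: eq_bigl => f; case Ff: (f \in F) => //; rewrite /transversal /= coset_reprM ?fsubV //.
by rewrite -(inj_eq (mulgI f)) mulVKg [RHS]eq_sym divg_eq eq_sym.
Qed.
End LocallyFinite.

(** * Vanishing in a tensor product is witnessed over a finite subgroup *)

Section FiniteLevel.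
Variables (k : pzRingType) (G : groupType).
Local Notation kG := (group_ring k G).
Variables (A : lmodType kG^c) (M : lmodType kG).

Definition balanced_over (F : {fset G}) (Z : zmodType) (b : A -> M -> Z) : Prop :=
  [/\ forall a a' m, b (a + a') m = b a m + b a' m,
      forall a m m', b a (m + m') = b a m + b a m' &
      forall a x c m, x \in F ->
        b ((gmon x c : kG^c) *: a) m = b a (gmon x c *: m)].

Lemma balanced_over_supp F (Z : zmodType) (b : A -> M -> Z) a (r : kG) m :
  balanced_over F b -> (msupp r `<=` F)%fset ->
  b ((r : kG^c) *: a) m = b a (r *: m).
Proof.
move=> [bDl bDr bZ] /fsubsetP rF.
have b0l m' : b 0 m' = 0 by apply: (addIr (b 0 m')); rewrite -bDl !add0r.
have b0r a' : b a' 0 = 0 by apply: (addIr (b a' 0)); rewrite -bDr !add0r.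
have -> : (r : kG^c) *: a = \sum_(x <- msupp r) (gmon x r@_x : kG^c) *: a.
  by rewrite [in LHS](monalgE r) scaler_suml.
have -> : r *: m = \sum_(x <- msupp r) gmon x r@_x *: m.
  by rewrite [in LHS](monalgE r) scaler_suml.
rewrite (big_morph (b^~ m) (fun a a' => bDl a a' m) (b0l m)).
rewrite (big_morph (b a) (bDr a) (b0r a)) [LHS]big_seq [RHS]big_seq.
by apply: eq_bigr => x /rF; apply: bZ.
Qed.

(** A proof that [u] vanishes in the tensor product uses finitely many
relations [a r (x) m = a (x) r m], and together the supports of these [r]
generate a finite subgroup [F].  The formal sums for which such a bound exists
form a subgroup containing all the relations. *)
Lemma tensor_null_finite (u : {malg (A * M)%type}) :
  locally_finite G -> u \in @tensor_null _ A M ->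
  exists2 F, finite_subgroup F &
    forall (Z : zmodType) (b : A -> M -> Z), balanced_over F b -> fsum b u = 0.
Proof.
move=> lfG /asboolP u0.
(* A list of group elements, rather than one F, makes S closed under subtraction. *)
pose S : {pred {malg (A * M)%type}} := fun t => `[< exists s : seq G,
  forall F, finite_subgroup F -> {subset s <= F} ->
  forall (Z : zmodType) (b : A -> M -> Z), balanced_over F b -> fsum b t = 0 >].
suff /asboolP[s su] : u \in S.
  by have [F subF sF] := locally_finite_fset s lfG; exists F => //; apply: su.
apply: u0.
  split=> [|t t' /asboolP[s st] /asboolP[s' st']]; apply/asboolP.
    by exists [::] => F _ _ Z b _; rewrite raddf0.
  exists (s ++ s') => F subF ss'F Z b bal.
  have sF : {subset s <= F} by move=> x xs; rewrite ss'F // mem_cat xs.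
  have s'F : {subset s' <= F} by move=> x xs; rewrite ss'F // mem_cat xs orbT.
  by rewrite raddfB /= (st F subF sF) // (st' F subF s'F) // subrr.
split=> [a a' m|a m m'|a r m]; apply/asboolP.
- exists [::] => F _ _ Z b [bDl _ _].
  by rewrite !raddfB /= !fsumU bDl -addrA -opprD subrr.
- exists [::] => F _ _ Z b [_ bDr _].
  by rewrite !raddfB /= !fsumU bDr -addrA -opprD subrr.
exists (msupp r) => F _ /fsubsetP rF Z b bal.
by rewrite raddfB /= !fsumU (balanced_over_supp _ _ bal rF) subrr.
Qed.
End FiniteLevel.

(** * Injective modules restricted to finite subgroups *)

Section Coinduced.
Variables (R : pzRingType) (I : lmodType R^c).

Definition additive_fun : {pred (R -> I)} := fun f => `[< zmod_morphism f >].

Lemma additive_fun_closed : zmod_closed additive_fun.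
Proof.
split=> [|f g /asboolP fB /asboolP gB]; apply/asboolP => x y.
  by rewrite subr0.
by rewrite !fctE fB gB !opprD !opprK addrACA.
Qed.

HB.instance Definition _ :=
  GRing.isZmodClosed.Build (R -> I) additive_fun additive_fun_closed.

(** The coinduced right module Hom_Z(R, I), with [(f . r)(x) = f(r x)]. *)
Record coinduced := Coinduced { coind_val :> R -> I; _ : coind_val \in additive_fun }.
HB.instance Definition _ := [isSub for coind_val].
HB.instance Definition _ := [Choice of coinduced by <:].
HB.instance Definition _ := [SubChoice_isSubZmodule of coinduced by <:].

Lemma coindB (f : coinduced) : zmod_morphism f.
Proof. by case: f => f fB; exact: asboolW fB. Qed.

HB.instance Definition _ f :=
  GRing.isZmodMorphism.Build R I (coind_val f) (coindB f).

Lemma coindP (f g : coinduced) : (forall x, f x = g x) -> f = g.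
Proof. by move=> fg; apply/val_inj/funext. Qed.

Definition mk_coind (f : R -> I) (fB : zmod_morphism f) : coinduced :=
  Coinduced (asboolT fB).

Lemma coind_sum (T : Type) (s : seq T) (F : T -> coinduced) x :
  (\sum_(t <- s) F t) x = \sum_(t <- s) F t x.
Proof. exact: (big_morph (fun f : coinduced => f x)). Qed.

Lemma coind_scale_subproof (r : R^c) (f : coinduced) :
  zmod_morphism (fun x : R => f ((r : R) * x)).
Proof. by move=> x y; rewrite mulrBr coindB. Qed.

Definition coind_scale r f : coinduced := mk_coind (coind_scale_subproof r f).

Lemma coind_scaleA r s f : coind_scale r (coind_scale s f) = coind_scale (r * s) f.
Proof. by apply: coindP => x /=; rewrite mulrA. Qed.
Lemma coind_scale1 : left_id 1 coind_scale.
Proof. by move=> f; apply: coindP => x /=; rewrite mul1r. Qed.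
Lemma coind_scaleDr : right_distributive coind_scale +%R.
Proof. by move=> r f g; apply: coindP. Qed.
Lemma coind_scaleDl f : {morph coind_scale^~ f : r s / r + s}.
Proof.
move=> r s; apply: coindP => x.
rewrite -[RHS]/(f ((r : R) * x) + f ((s : R) * x)) /= -raddfD.
by congr (coind_val f _); apply: mulrDl.
Qed.

HB.instance Definition _ := GRing.Zmodule_isLmodule.Build R^c coinduced
  coind_scaleA coind_scale1 coind_scaleDr coind_scaleDl.

End Coinduced.

Section Trace.
Variables (R : pzRingType) (I : lmodType R^c).

Lemma orbit_subproof (i : I) : zmod_morphism (fun x : R => (x : R^c) *: i).
Proof. by move=> x y; rewrite scalerBl. Qed.

Definition orbit_map (i : I) : coinduced I := mk_coind (orbit_subproof i).

Lemma orbit_map_linear : linear orbit_map.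
Proof.
by move=> c i j; apply: coindP => x /=; rewrite scalerDr scalerA.
Qed.

HB.instance Definition _ :=
  GRing.isLinear.Build R^c I (coinduced I) *:%R orbit_map orbit_map_linear.

(** The orbit map [i |-> (x |-> i x)] is an embedding of [I], and an injective
module is a retract of every module that contains it. *)
Lemma coinduced_retraction : injective_module I ->
  exists rho : {linear coinduced I -> I}, forall i, rho (orbit_map i) = i.
Proof.
move=> /(_ I (coinduced I) (orbit_map : {linear _ -> _}) (idfun : {linear _ -> _})).
apply=> i j /(congr1 (fun f : coinduced I => f 1)) /=.
by rewrite !scale1r.
Qed.
End Trace.

Section Higman.
Variables (k : comPzRingType) (G : groupType) (F : {fset G}).
Local Notation kG := (group_ring k G).
Hypothesis subF : finite_subgroup F.

(** The part of [r] supported on the transversal of [F]: the projection of [kG]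
onto one of the summands in the decomposition of [kG] into its left translates
by [F]. *)
Definition cut (r : kG) : kG :=
  [malg x in msupp r => if transversal F x then r@_x else 0].

Lemma mcoeff_cut r x : (cut r)@_x = if transversal F x then r@_x else 0.
Proof. by rewrite mcoeffE; case: msuppP => // _; rewrite if_same. Qed.

Lemma cutB : zmod_morphism cut.
Proof.
by move=> r s; apply/malgP => x; rewrite mcoeffB !mcoeff_cut mcoeffB; case: ifP; rewrite ?subr0.
Qed.

Lemma cut_scale c r : cut (gmon 1%g c * r) = gmon 1%g c * cut r.
Proof.
apply/malgP => x; rewrite mcoeff_gmonM !mcoeff_cut mcoeff_gmonM invg1 mul1g.
by case: ifP; rewrite ?mulr0.
Qed.

Lemma cut_sum r : \sum_(f <- F) gmon f 1 * cut (gmon f^-1%g 1 * r) = r.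
Proof.
apply/malgP => x; rewrite raddf_sum /= -[RHS](sum_transversal subF x) [RHS]big_mkcond.
apply: eq_bigr => f _; rewrite mcoeff_gmonM mcoeff_cut mcoeff_gmonM.
by rewrite invgK mulVKg; case: ifP; rewrite ?mul1r ?mulr0.
Qed.

(** Higman's criterion of relative projectivity for the restriction of [I] to
[F].  If [rho] retracts the coinduced module onto [I], take
[psi i = rho (x |-> i (cut x))]: the translates of [cut] by [F] add up to the
identity, so those of [psi] add up to [rho (x |-> i x) = i]. *)
Lemma injective_trace (I : lmodType kG^c) : injective_module I ->
  exists psi : {additive I -> I},
    (forall c i, psi ((gmon 1%g c : kG^c) *: i) = (gmon 1%g c : kG^c) *: psi i) /\
    (forall i, \sum_(f <- F)
       (gmon f^-1%g 1 : kG^c) *: psi ((gmon f 1 : kG^c) *: i) = i).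
Proof.
move=> /coinduced_retraction [rho rhoK].
have tB (i : I) : zmod_morphism (fun x : kG => (cut x : kG^c) *: i).
  by move=> x y; rewrite cutB scalerBl.
have psiB : zmod_morphism (fun i : I => rho (mk_coind (tB i))).
  move=> i j; rewrite -raddfB; congr (rho _).
  by apply: coindP => x /=; rewrite scalerBr.
pose psi : {additive I -> I} := HB.pack (fun i : I => rho (mk_coind (tB i)))
  (GRing.isZmodMorphism.Build I I _ psiB).
exists psi; split=> [c i|i]; rewrite /psi /=.
  rewrite -linearZ; congr (rho _); apply: coindP => x /=.
  by rewrite cut_scale scalerA.
rewrite -[RHS]rhoK; under eq_bigr => f _ do rewrite -linearZ.
rewrite -(raddf_sum rho); congr (rho _); apply: coindP => r.
rewrite coind_sum /= -[in RHS](cut_sum r).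
rewrite (@scaler_suml kG^c I).
by apply: eq_bigr => f _; rewrite scalerA.
Qed.
End Higman.

(** * Contractible complexes tensored with injective modules *)

Section TensorContraction.
Variables (k : comPzRingType) (G : groupType).
Local Notation kG := (group_ring k G).

Definition commutes_with_scalars (M N : lmodType kG) (s : M -> N) : Prop :=
  forall c x, s (gmon 1%g c *: x) = gmon 1%g c *: s x.

Section Transfer.
Variables (F : {fset G}) (I : lmodType kG^c) (M N : lmodType kG).
Variables (psi : {additive I -> I}) (s : {additive M -> N}).

(** The average over [F] of [psi (x) s].  It is balanced over [kF] although
[psi] and [s] are only [k]-linear. *)
Definition transfer (i : I) (x : M) : tensor I N :=
  \sum_(f <- F) tens (psi ((gmon f 1 : kG^c) *: i)) (s (gmon f^-1%g 1 *: x)).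

Lemma transfer_balanced : finite_subgroup F ->
  (forall c i, psi ((gmon 1%g c : kG^c) *: i) = (gmon 1%g c : kG^c) *: psi i) ->
  commutes_with_scalars s -> balanced_over F transfer.
Proof.
move=> subF psiZ sZ; split=> [i i' m|i m m'|i x c m Fx].
- rewrite -big_split; apply: eq_bigr => f _ /=.
  by rewrite scalerDr raddfD tensDl.
- rewrite -big_split; apply: eq_bigr => f _ /=.
  by rewrite scalerDr raddfD tensDr.
(* Reindex f as x f on the right; the scalar c then moves across the tensor. *)
rewrite /transfer -[RHS](fsub_shift subF _ Fx); apply: eq_bigr => f _.
have -> : (gmon f 1 : kG^c) *: ((gmon x c : kG^c) *: i) =
          (gmon 1%g c : kG^c) *: ((gmon (x * f)%g 1 : kG^c) *: i).
  rewrite !scalerA; congr (_ *: _).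
  rewrite -[LHS]/(gmon x c * gmon f 1) -[RHS]/(gmon _ 1 * gmon _ c).
  by rewrite !gmonM mulg1 mulr1 mul1r.
by rewrite psiZ tensZ -sZ !scalerA !gmonM mul1g invgM mulgVK mulr1 mul1r.
Qed.
End Transfer.

Variables (P N M : lmodType kG).
Variables (d1 : {linear P -> N}) (d0 : {linear N -> M}).
Variables (s1 : {additive N -> P}) (s0 : {additive M -> N}).

(** Let [t] be represented by a formal sum [u] whose image under [d0] is null.
Over a suitable finite [F] the balanced map [transfer F psi s0] kills that
image, so the homotopy identity, averaged with [psi], reads
[t = d1 (transfer F psi s1 u)]. *)
Lemma contraction_tensor_exact (I : lmodType kG^c) :
  locally_finite G -> injective_module I ->
  (forall x, d0 (d1 x) = 0) ->
  commutes_with_scalars s1 -> commutes_with_scalars s0 ->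
  (forall x, d1 (s1 x) + s0 (d0 x) = x) ->
  exact (tensor_map (idfun : {linear I -> I}) d1)
        (tensor_map (idfun : {linear I -> I}) d0).
Proof.
move=> lfG injI dd s1Z s0Z htpy t; have [u ->] := tensor_fsum t.
split=> [du0|[w <-]]; last first.
  have [v ->] := tensor_fsum w.
  rewrite (raddf_fsum (tensor_map idfun d1)) (raddf_fsum (tensor_map idfun d0)).
  rewrite -[RHS](fsum0 _ v); apply: eq_fsum => i n.
  by rewrite /= !tensor_mapE /= dd raddf0.
pose v : {malg (I * M)%type} := fsum (fun i n => << (i, d0 n) >>) u.
have v0 : v \in @tensor_null _ I M.
  apply/tensor_piP; rewrite tensor_pi raddf_fsum -[RHS]du0.
  rewrite (raddf_fsum (tensor_map idfun d0)).
  by apply: eq_fsum => i n; rewrite /= fsumU tensor_mapE.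
have [F subF Fv0] := tensor_null_finite lfG v0.
have [psi [psiZ psi_tr]] := injective_trace subF injI.
have := Fv0 _ _ (transfer_balanced subF psiZ s0Z); rewrite raddf_fsum => v00.
exists (fsum (transfer F psi s1) u).
rewrite (raddf_fsum (tensor_map idfun d1)) -[LHS]addr0 -{}[X in _ + X]v00 -fsumD.
apply: eq_fsum => i n; rewrite /= fsumU raddf_sum -big_split /= -[in RHS](psi_tr i) tens_suml.
by apply: eq_bigr => f _; rewrite /= tensor_mapE -tensDr tensZ -linearZ htpy.
Qed.

End TensorContraction.

(** * Flatness of modules of finite-valued functions *)

Section CommonPartition.
Variables (V J Y : choiceType).


Lemma finite_range_map (s : seq J) (H : J -> Y -> V) :
  (forall j, finite_set (range (H j))) ->
  finite_set (range (fun y => [seq H j y | j <- s])).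
Proof.
move=> finH; elim: s => [|j s IHs] /=.
  by apply: (@sub_finite_set _ _ [set [::]]%classic) => // _ [y _ <-].
apply: (@sub_finite_set _ _ [set v :: w | v in range (H j) &
  w in range (fun y => [seq H j y | j <- s])]%classic).
  move=> _ [y _ <-]; exists (H j y); first by exists y.
  by exists [seq H j y | j <- s]; first by exists y.
exact: finite_image2.
Qed.
End CommonPartition.

(** The functions [H j], for [j] in [s], are constant on the fibres of the map
[Phi] collecting their values, and [Phi] takes finitely many values.  [E]
contains one point of each fibre on which the functions do not all vanish; this
restriction keeps the indicator functions of the fibres of finite support when
the [H j] have finite support. *)
Lemma common_partition (k : zmodType) (J Y : choiceType)
    (s : seq J) (H : J -> Y -> k) :
  (forall j, finite_set (range (H j))) ->
  exists E : seq Y,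
    (forall e, e \in E -> exists2 j, j \in s & H j e <> 0) /\
    (forall y j, j \in s ->
      \sum_(e <- E | [seq H i e | i <- s] == [seq H i y | i <- s]) H j e = H j y).
Proof.
move=> finH; pose Phi y := [seq H j y | j <- s].
pose D : set Y := [set y | exists2 j, j \in s & H j y <> 0]%classic.
have finV : finite_set (Phi @` D)%classic.
  by apply: sub_finite_set (finite_range_map s finH) => _ [y _ <-]; exists y.
have [E EV ED] : exists2 E : seq Y, map Phi E = fset_set (Phi @` D)%classic &
    forall e, e \in E -> D e.
  have : forall v, v \in (fset_set (Phi @` D)%classic : seq (seq k)) ->
      exists2 y, D y & Phi y = v.
    by move=> v; rewrite in_fset_set // inE.
  elim: (fset_set _ : seq _) => [|v vs IHvs] vsD; first by exists [::].
  have [|E EV ED] := IHvs; first by move=> w wvs; apply: vsD; rewrite in_cons wvs orbT.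
  have [y Dy yv] := vsD v (mem_head _ _).
  exists (y :: E) => [|e]; first by rewrite /= yv EV.
  by rewrite in_cons => /predU1P[->|/ED].
exists E; split=> [e /ED //|y j js].
have mapE i e : i \in s -> Phi e = Phi y -> H i e = H i y.
  by move=> i_s /eq_in_map; apply.
transitivity (\sum_(e <- E | Phi e == Phi y) H j y).
  by apply: eq_bigr => e /eqP; apply: mapE.
rewrite -(big_map Phi (pred1 (Phi y)) (fun=> H j y)) EV.
(* A fibre without representative in E is one where all the functions vanish. *)
have [Vy|Vy] := boolP (Phi y \in fset_set (Phi @` D)%classic).
  by rewrite -big_filter filter_pred1_uniq ?fset_uniq // big_seq1.
rewrite big_seq_cond big1 => [|v /andP[+ /eqP vy]]; last by rewrite vy (negPf Vy).
apply/esym; apply: contrapT => yj_neq0; move/negP: Vy; apply.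
rewrite in_fset_set // inE; exists y => //.
by exists j.
Qed.

Section FunctionModules.
Variables (k : comPzRingType) (G : groupType).
Local Notation kG := (group_ring k G).

(** The equivariant map [base] to [G] makes the action free, and pulls
transversals of finite subgroups back from [G]. *)
Record free_action := FreeAction {
  points :> choiceType;
  act : G -> points -> points;
  base : points -> G;
  act1 : forall y, act 1%g y = y;
  actM : forall g h y, act (g * h)%g y = act g (act h y);
  base_act : forall g y, base (act g y) = (g * base y)%g }.

Variable Y : free_action.

(** [M] is, via [ev], a module of finite-valued functions on [Y].  The axiom
[ev_indicator] holds both for all finite-valued functions and for all functions
of finite support, which allows chains and cochains to be treated alike. *)
Record function_module (M : lmodType kG) := FunctionModule {
  ev : M -> Y -> k;
  evD : forall m m' y, ev (m + m') y = ev m y + ev m' y;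
  evZ : forall g c m y, ev (gmon g c *: m) y = c * ev m (act g^-1%g y);
  ev_inj : forall m m', (forall y, ev m y = ev m' y) -> m = m';
  ev_finite : forall m, finite_set (range (ev m));
  ev_indicator : forall (s : seq (M * G)) (P : pred Y),
    (forall y, P y -> exists2 j, j \in s & ev j.1 (act j.2 y) <> 0) ->
    exists m, forall y, ev m y = (P y)%:R }.

Variables (M : lmodType kG) (fM : function_module M).
Local Notation "m @@ y" := (ev fM m y) (at level 20).

Lemma ev0 y : 0 @@ y = 0.
Proof. by apply: (addIr (0 @@ y)); rewrite -evD !add0r. Qed.

Lemma ev_sum (T : Type) (s : seq T) (P : pred T) (E : T -> M) y :
  (\sum_(t <- s | P t) E t) @@ y = \sum_(t <- s | P t) E t @@ y.
Proof. exact: (big_morph (fun m => m @@ y) (fun m m' => evD fM m m' y) (ev0 y)). Qed.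

Section Orbit.
Variable F : {fset G}.

(** The restriction of [m] to the [F]-orbit of [y], read as an element of [kF]. *)
Definition orbit_coef (m : M) (y : Y) : kG :=
  \sum_(f <- F) gmon f (m @@ (act f y)).

Lemma orbit_coefD m m' y :
  orbit_coef (m + m') y = orbit_coef m y + orbit_coef m' y.
Proof.
by rewrite -big_split; apply: eq_bigr => f _; rewrite evD gmonDr.
Qed.

Hypothesis subF : finite_subgroup F.

Lemma orbit_coefZ g c m y : g \in F ->
  orbit_coef (gmon g c *: m) y = gmon g c * orbit_coef m y.
Proof.
move=> Fg; rewrite /orbit_coef mulr_sumr -(fsub_shift subF _ Fg).
by apply: eq_bigr => f _; rewrite evZ gmonM -actM mulKg.
Qed.

(** Each [m] is the sum over [f] in [F] of the translates by [f] of functions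
supported on a fundamental domain for [F]; there, the functions
[y |-> m (f y)], for all [m] and [f] together, are combinations of the
indicator functions [chi e] of the blocks of a common partition. *)
Lemma orbit_decomposition (ms : seq M) :
  exists (E : seq Y) (chi : Y -> M),
    forall m, m \in ms -> m = \sum_(e <- E) orbit_coef m e *: chi e.
Proof.
pose H (j : M * G) (y : Y) := j.1 @@ (act j.2 y).
pose s := [seq (m, f) | m <- ms, f <- F].
have finH j : finite_set (range (H j)).
  by apply: sub_finite_set (ev_finite fM j.1) => _ [y _ <-]; exists (act j.2 y).
have [E [Es HE]] := common_partition s finH.
pose P e y := transversal F (base y) &&
  ([seq H i e | i <- s] == [seq H i y | i <- s]).
have chi_ex e : exists m, e \in E -> forall y, m @@ y = (P e y)%:R.
  have [eE|_] := boolP (e \in E); last by exists 0.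
  have [j js Hj] := Es e eE.
  have [|m mP] := @ev_indicator _ fM s (P e); last by exists m.
  move=> y /andP[_ /eqP/eq_in_map eH]; exists j => //.
  by move: Hj; rewrite (eH _ js).
pose chi e := xget 0 [set m | e \in E -> forall y, m @@ y = (P e y)%:R]%classic.
have chiE e y : e \in E -> chi e @@ y = (P e y)%:R.
  have [m mP] := chi_ex e; move=> eE.
  exact: (@xgetPex _ 0 [set m | e \in E -> forall y, m @@ y = (P e y)%:R]%classic (ex_intro _ m mP)).
exists E, chi => m ms_m; apply: (ev_inj (f := fM)) => y.
rewrite ev_sum.
(* For given y a single f, the one carrying the domain to y, contributes m y. *)
transitivity (\sum_(f <- F) \sum_(e <- E) m @@ (act f e) * (P e (act f^-1%g y))%:R).
  under eq_bigr => f _ do under eq_bigr => e _ do rewrite /P.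
  rewrite -[LHS](sum_transversal subF (base y)) big_mkcond /= big_seq [RHS]big_seq.
  apply: eq_bigr => f Ff; rewrite base_act; case: ifP => _; last first.
    by rewrite big1 // => e _; rewrite mulr0.
  rewrite -[in LHS](act1 y) -(mulgV f) actM.
  have mfs : (m, f) \in s by apply/allpairsP; exists (m, f).
  rewrite -[LHS](HE (act f^-1%g y) (m, f) mfs) big_mkcond.
  by apply: eq_bigr => e _; case: ifP; rewrite /= ?mulr1 ?mulr0.
rewrite exchange_big /= big_seq [RHS]big_seq; apply: eq_bigr => e eE.
rewrite scaler_suml ev_sum; apply: eq_bigr => f _.
by rewrite evZ chiE.
Qed.
End Orbit.

(** By [orbit_decomposition], an element [u] of [A (x) M] equals
[sum_e beta_e(u) (x) chi e], where [beta_e (a (x) m) = a (orbit_coef m e)] is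
balanced over [kF] and natural in [A].  If the image of [u] under an injective
[f] vanishes, then [f (beta_e u) = 0], hence [beta_e u = 0], for every [e]. *)
Lemma function_module_flat : locally_finite G -> flat M.
Proof.
move=> lfG A B f inj_f.
suff ker0 t : tensor_map f (idfun : {linear M -> M}) t = 0 -> t = 0.
  move=> t t' /eqP; rewrite -subr_eq0 -raddfB => /eqP/ker0/eqP.
  by rewrite subr_eq0 => /eqP.
have [u ->] := tensor_fsum t => fu0.
pose v : {malg (B * M)%type} := fsum (fun a m => << (f a, m) >>) u.
have v0 : v \in @tensor_null _ B M.
  apply/tensor_piP; rewrite tensor_pi raddf_fsum -[RHS]fu0.
  rewrite (raddf_fsum (tensor_map f idfun)).
  by apply: eq_fsum => a m; rewrite /= fsumU tensor_mapE.
have [F subF Fv0] := tensor_null_finite lfG v0.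
have [E [chi msE]] := orbit_decomposition subF [seq p.2 | p <- msupp u].
transitivity (fsum (fun a m => \sum_(e <- E)
    tens ((orbit_coef F m e : kG^c) *: a) (chi e)) u).
  apply: eq_in_fsum => -[a m] /= um.
  rewrite [in LHS](msE m) ?raddf_sum; last exact: (map_f snd um).
  by apply: eq_bigr => e _; rewrite /= tensZ.
rewrite fsum_sum big1 // => e _.
suff -> : fsum (fun a m => tens ((orbit_coef F m e : kG^c) *: a) (chi e)) u =
          tens (fsum (fun a m => (orbit_coef F m e : kG^c) *: a) u) (chi e).
  suff -> : fsum (fun a m => (orbit_coef F m e : kG^c) *: a) u = 0 by rewrite tens0l.
  apply: inj_f; rewrite raddf0 raddf_fsum.
  rewrite -[RHS](Fv0 _ (fun b m => (orbit_coef F m e : kG^c) *: b)).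
    by rewrite raddf_fsum; apply: eq_fsum => a m; rewrite /= fsumU linearZ.
  split=> [a a' m|a m m'|a g c m Fg]; first by rewrite scalerDr.
    by rewrite orbit_coefD scalerDl.
  by rewrite orbit_coefZ // scalerA.
by rewrite -/(tensl _ _) raddf_fsum.
Qed.
End FunctionModules.

(** * Modules over a group ring given by the action of monomials *)

Section MonomialAction.
Variables (k : pzRingType) (G : groupType) (V : zmodType).
Local Notation kG := (group_ring k G).
Variable sh : G -> k -> V -> V.
Hypothesis shDl : forall x a b v, sh x (a + b) v = sh x a v + sh x b v.
Hypothesis shDr : forall x a v w, sh x a (v + w) = sh x a v + sh x a w.
Hypothesis shM : forall x y a b v, sh x a (sh y b v) = sh (x * y)%g (a * b) v.
Hypothesis sh1 : forall v, sh 1%g 1 v = v.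

Definition monomial_scale (r : kG) (v : V) : V := \sum_(x <- msupp r) sh x r@_x v.

Let sh0l x v : sh x 0 v = 0.
Proof. by apply: (addIr (sh x 0 v)); rewrite -shDl !add0r. Qed.

Let sh0r x a : sh x a 0 = 0.
Proof. by apply: (addIr (sh x a 0)); rewrite -shDr !add0r. Qed.

Let scalew (d : {fset G}) r v :
  (msupp r `<=` d)%fset -> monomial_scale r v = \sum_(x <- d) sh x r@_x v.
Proof. by move=> le; apply/big_fset_incl => // x _ /mcoeff_outdom ->. Qed.

Lemma monomial_scale_gmon x a v : monomial_scale (gmon x a) v = sh x a v.
Proof. by rewrite (scalew _ msuppU_le) big_seq_fset1 mcoeffUU. Qed.

Lemma monomial_scaleDl v : {morph monomial_scale^~ v : r s / r + s}.
Proof.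
move=> r s; set d := (msupp r `|` msupp s)%fset.
rewrite (@scalew d (r + s)) ?msuppD_le // (@scalew d r) ?fsubsetUl //.
rewrite (@scalew d s) ?fsubsetUr // -big_split.
by apply/eq_bigr=> x _; rewrite mcoeffD shDl.
Qed.

Lemma monomial_scaleDr : right_distributive monomial_scale +%R.
Proof. by move=> r v w; rewrite -big_split; apply: eq_bigr => x _; apply: shDr. Qed.

Lemma monomial_scale1 : left_id 1 monomial_scale.
Proof. by move=> v; rewrite -gmon1 monomial_scale_gmon. Qed.

Lemma monomial_scaleA r s v :
  monomial_scale r (monomial_scale s v) = monomial_scale (r * s) v.
Proof.
have scale0l w : monomial_scale 0 w = 0 by rewrite /monomial_scale msupp0 big_seq_fset0.
have scale0r t : monomial_scale t 0 = 0 by apply: big1.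
elim/group_ring_ind: r => [|r r' IHr IHr'|x a].
- by rewrite mul0r !scale0l.
- by rewrite mulrDl !monomial_scaleDl IHr IHr'.
elim/group_ring_ind: s => [|s s' IHs IHs'|y b].
- by rewrite mulr0 scale0l scale0r.
- by rewrite mulrDr !monomial_scaleDl monomial_scaleDr IHs IHs'.
by rewrite gmonM !monomial_scale_gmon.
Qed.
End MonomialAction.

Lemma linear_of_gmon (k : pzRingType) (G : groupType)
    (M N : lmodType (group_ring k G)) (d : {additive M -> N}) :
  (forall x a m, d (gmon x a *: m) = gmon x a *: d m) -> linear d.
Proof.
move=> dZ r m m'; rewrite raddfD; congr (_ + _).
elim/group_ring_ind: r => [|r r' IHr IHr'|x a]; last exact: dZ.
  by rewrite !scale0r raddf0.
by rewrite !scalerDl raddfD IHr IHr'.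
Qed.

(** * Chains on a free G-set *)

Section Chains.
Variables (k : comPzRingType) (G : groupType).
Local Notation kG := (group_ring k G).

Definition chains (Y : free_action G) : Type := {malg k[Y]}.
HB.instance Definition _ Y := GRing.Zmodule.on (chains Y).

Definition cell (Y : free_action G) (y : Y) (a : k) : chains Y := mkmalgU y a.

HB.instance Definition _ Y y := GRing.Additive.copy (@cell Y y) (@mkmalgU Y k y).

Lemma chains_ind Y (P : chains Y -> Prop) :
  P 0 -> (forall c c', P c -> P c' -> P (c + c')) ->
  (forall x a, P (cell x a)) -> forall c, P c.
Proof. exact: malg_ind. Qed.

Definition chain_lift (Y : free_action G) (Z : zmodType) (h : Y -> {additive k -> Z}) :
  chains Y -> Z := malg_lift h.
HB.instance Definition _ Y Z h :=
  GRing.Additive.copy (@chain_lift Y Z h) (malg_lift h).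

Lemma chain_lift_cell (Y : free_action G) (Z : zmodType) (h : Y -> {additive k -> Z}) y a :
  chain_lift h (cell y a) = h y a.
Proof. exact: malg_liftU. Qed.

Section Shift.
Variable Y : free_action G.

Definition shift (x : G) (a : k) : chains Y -> chains Y :=
  chain_lift (fun y : Y => (cell (act x y) \o (a \*o idfun))).

HB.instance Definition _ x a := GRing.Additive.on (shift x a).

Lemma shift_cell x a y b : shift x a (cell y b) = cell (act x y) (a * b).
Proof. exact: chain_lift_cell. Qed.

Lemma shiftDr x a v w : shift x a (v + w) = shift x a v + shift x a w.
Proof. exact: raddfD. Qed.

Lemma shiftDl x a b v : shift x (a + b) v = shift x a v + shift x b v.
Proof.
elim/chains_ind: v => [|v w IHv IHw|y c]; rewrite ?raddf0 ?addr0 //.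
  by rewrite !shiftDr IHv IHw addrACA.
by rewrite !shift_cell mulrDl raddfD.
Qed.

Lemma shiftM x y a b v : shift x a (shift y b v) = shift (x * y)%g (a * b) v.
Proof.
elim/chains_ind: v => [|v w IHv IHw|z c]; rewrite ?raddf0 //.
  by rewrite !shiftDr IHv IHw.
by rewrite !shift_cell actM mulrA.
Qed.

Lemma shift1 v : shift 1%g 1 v = v.
Proof.
elim/chains_ind: v => [|v w IHv IHw|z c]; rewrite ?raddf0 //.
  by rewrite !shiftDr IHv IHw.
by rewrite shift_cell act1 mul1r.
Qed.

HB.instance Definition _ := GRing.Zmodule_isLmodule.Build kG (chains Y)
  (monomial_scaleA shiftDl shiftDr shiftM) (monomial_scale1 shiftDl shift1)
  (monomial_scaleDr shiftDr) (monomial_scaleDl shiftDl).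

Lemma gmon_chain x a (v : chains Y) : gmon x a *: v = shift x a v.
Proof. exact: (monomial_scale_gmon shiftDl). Qed.

Lemma mcoeff_shift x a v y : (shift x a v)@_y = a * v@_(act x^-1%g y).
Proof.
elim/chains_ind: v => [|v w IHv IHw|z c]; rewrite ?raddf0 ?mcoeff0 ?mulr0 //.
  by rewrite shiftDr !mcoeffD IHv IHw mulrDr.
rewrite shift_cell !mcoeffU -mulrnAr; congr (_ * (_ *+ nat_of_bool _)).
by apply/eqP/eqP => [<-|->]; rewrite -actM ?mulVg ?mulgV act1.
Qed.

Lemma chains_function_module : function_module Y (chains Y : lmodType kG).
Proof.
exists (fun (c : chains Y) y => c@_y).
- by move=> c c' y; rewrite mcoeffD.
- by move=> g a c y; rewrite gmon_chain mcoeff_shift.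
- by move=> c c' cc'; apply/malgP.
- move=> c; apply: (@sub_finite_set _ _ ([set 0] `|` (fun y => c@_y) @` [set` msupp c])%classic).
    move=> _ [y _ <-]; have [yc|yc] := msuppP c y; last by left.
    by right; exists y.
  by rewrite finite_setU; split; [exact: finite_set1|exact/finite_image/finite_fset].
move=> s P Ps.
pose L := [seq act j.2^-1%g y | j : chains Y * G <- s, y <- msupp (j.1 : {malg k[Y]})].
exists ([malg y in [fset y in L]%fset => (P y)%:R] : {malg k[Y]}) => y.
rewrite mcoeffE inE /=; case: ifP => // /negP yL.
case: (boolP (P y)) => // /Ps[j js jy]; case: yL.
apply/allpairsPdep; exists j, (act j.2 y); split=> //.
  by rewrite -mcoeff_neq0; apply/eqP.
by rewrite -actM mulVg act1.
Qed.
End Shift.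
End Chains.

(** * The homogeneous bar complex *)

Section Bar.
Variables (k : comPzRingType) (G : groupType).
Local Notation kG := (group_ring k G).

Definition regular_action : free_action G :=
  @FreeAction G G (fun g y => g * y)%g id (@mul1g G) (fun g h y => esym (mulgA g h y))
    (fun _ _ => erefl).

Definition cone_act (Y : free_action G) (g : G) (p : G * Y) : G * Y :=
  ((g * p.1)%g, act g p.2).

Lemma cone_act1 Y p : @cone_act Y 1%g p = p.
Proof. by case: p => x y; rewrite /cone_act mul1g act1. Qed.

Lemma cone_actM Y g h p : @cone_act Y (g * h)%g p = cone_act g (cone_act h p).
Proof. by rewrite /cone_act mulgA actM. Qed.

Definition cone_action (Y : free_action G) : free_action G :=
  @FreeAction G (G * Y)%type (@cone_act Y) fst (@cone_act1 Y) (@cone_actM Y)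
    (fun _ _ => erefl).

(** The diagonal action on [G^(n+1)]. *)
Fixpoint bar (n : nat) : free_action G :=
  if n is n'.+1 then cone_action (bar n') else regular_action.

Local Notation C n := (chains k (bar n)).

Definition cone (Y : free_action G) (x : G) : chains k Y -> chains k (cone_action Y) :=
  chain_lift (fun y => @cell k G (cone_action Y) (x, y)).
HB.instance Definition _ Y x := GRing.Additive.on (@cone Y x).

Lemma cone_cell (Y : free_action G) x (y : Y) a :
  cone x (cell y a) = @cell k G (cone_action Y) (x, y) a.
Proof. exact: chain_lift_cell. Qed.

Lemma coneD (Y : free_action G) x (c c' : chains k Y) :
  cone x (c + c') = cone x c + cone x c'.
Proof. exact: raddfD. Qed.

Lemma shift_cone (Y : free_action G) g b x (c : chains k Y) :
  shift g b (cone x c) = cone (g * x)%g (shift g b c).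
Proof.
elim/chains_ind: c => [|c c' IHc IHc'|y a]; first by rewrite !raddf0.
  by rewrite coneD !shiftDr coneD IHc IHc'.
by rewrite shift_cell !cone_cell shift_cell.
Qed.

(** The boundary [sum_i (-1)^i (x_0, .., x_i omitted, .., x_(n+1))] of the cell
[p], with coefficient [a].  Omitting the first coordinate gives the first
term; the remaining terms form the cone over the boundary of the last
coordinates.  With this recursion, that the boundary squares to zero and that
cones contract it follow without simplicial identities. *)
Fixpoint face (n : nat) : bar n.+1 -> k -> C n :=
  match n return bar n.+1 -> k -> C n with
  | 0 => fun p a => cell p.2 a - cell (p.1 : bar 0) a
  | n'.+1 => fun p a => cell p.2 a - cone p.1 (face p.2 a)
  end.

Lemma face_zmod_morphism n (p : bar n.+1) : zmod_morphism (face p).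
Proof.
elim: n p => [|n IHn] [x y] a b /=.
  by rewrite !(raddfB (cell _)) !opprD !opprK addrACA.
by rewrite IHn (raddfB (cell _)) (raddfB (cone _)) !opprD !opprK addrACA.
Qed.

HB.instance Definition _ n p :=
  GRing.isZmodMorphism.Build k (C n) (@face n p) (@face_zmod_morphism n p).

Lemma face_act n (p : bar n.+1) g a b :
  face (act g p) (b * a) = shift g b (face p a).
Proof.
elim: n p => [|n IHn] [x y] /=.
  by rewrite raddfB /= !shift_cell.
by rewrite raddfB /= shift_cell shift_cone -IHn.
Qed.

Definition bd (n : nat) : C n.+1 -> C n := chain_lift (@face n).
HB.instance Definition _ n := GRing.Additive.on (@bd n).

Lemma bdD n (c c' : C n.+1) : bd (c + c') = bd c + bd c'.
Proof. exact: raddfD. Qed.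

Lemma bd_cell n (p : bar n.+1) a : bd (cell p a) = face p a.
Proof. exact: chain_lift_cell. Qed.

Lemma bd_gmon n g b (c : C n.+1) : bd (gmon g b *: c) = gmon g b *: bd c.
Proof.
rewrite !gmon_chain; elim/chains_ind: c => [|c c' IHc IHc'|p a].
- by rewrite !raddf0.
- by rewrite shiftDr !bdD shiftDr IHc IHc'.
by rewrite shift_cell !bd_cell face_act.
Qed.

Definition aug : C 0 -> k := chain_lift (fun _ => idfun).
HB.instance Definition _ := GRing.Additive.on aug.

Lemma augD c c' : aug (c + c') = aug c + aug c'.
Proof. exact: raddfD. Qed.

Lemma aug_cell x a : aug (cell x a) = a.
Proof. exact: chain_lift_cell. Qed.

Lemma aug_shift g b c : aug (shift g b c) = b * aug c.
Proof.
elim/chains_ind: c => [|c c' IHc IHc'|x a].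
- by rewrite !raddf0 mulr0.
- by rewrite shiftDr !augD mulrDr IHc IHc'.
by rewrite shift_cell !aug_cell.
Qed.

Lemma bd_cone0 x (c : C 0) : bd (cone x c : C 1) = c - cell (x : bar 0) (aug c).
Proof.
elim/chains_ind: c => [|c c' IHc IHc'|y a].
- by rewrite !raddf0 addr0.
- by rewrite coneD (@bdD 0) IHc IHc' augD raddfD opprD addrACA.
by rewrite cone_cell bd_cell aug_cell.
Qed.

Lemma bd_cone n x (c : C n.+1) : bd (cone x c : C n.+2) = c - cone x (bd c).
Proof.
elim/chains_ind: c => [|c c' IHc IHc'|y a].
- by rewrite !raddf0 addr0.
- rewrite coneD (@bdD n.+1) IHc IHc' bdD coneD.
  by rewrite opprD addrACA.
by rewrite cone_cell !bd_cell.
Qed.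

Lemma aug_face (p : bar 1) a : aug (face p a) = 0.
Proof. by case: p => x y; rewrite raddfB /= !aug_cell subrr. Qed.

Lemma aug_bd (c : C 1) : aug (bd c) = 0.
Proof.
elim/chains_ind: c => [|c c' IHc IHc'|y a].
- by rewrite !raddf0.
- by rewrite bdD augD IHc IHc' addr0.
by rewrite bd_cell aug_face.
Qed.

Lemma bd0 n : bd (0 : C n.+1) = 0.
Proof. exact: raddf0. Qed.

Lemma bdB n (c c' : C n.+1) : bd (c - c') = bd c - bd c'.
Proof. exact: raddfB. Qed.

Lemma face_bar0 x (y : bar 0) a :
  face ((x, y) : bar 1) a = cell y a - cell (x : bar 0) a.
Proof. by []. Qed.

Lemma face_cone n x (y : bar n.+1) a :
  face ((x, y) : bar n.+2) a = cell y a - cone x (face y a).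
Proof. by []. Qed.

Lemma bd_face0 (p : bar 2) a : bd (face p a) = 0.
Proof.
case: p => x y.
rewrite face_cone bdB bd_cell bd_cone0.
by rewrite aug_face (raddf0 (cell _)) subr0 subrr.
Qed.

(** By [bd_cone], both terms of [face_cone] have the same boundary, up to the
cone over an iterated boundary. *)
Lemma bd_face n (p : bar n.+2) a : bd (face p a) = 0.
Proof.
elim: n p a => [|n IHn] p a; first exact: bd_face0.
case: p => x y.
rewrite face_cone bdB bd_cell bd_cone IHn.
by rewrite (raddf0 (cone x)) subr0 subrr.
Qed.

Lemma bd_bd n (c : C n.+2) : bd (bd c) = 0.
Proof.
elim/chains_ind: c => [|c c' IHc IHc'|p a].
- by rewrite !bd0.
- by rewrite !bdD IHc IHc' addr0.
by rewrite bd_cell bd_face.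
Qed.
End Bar.

(** * Finite-valued cochains *)

Section Cochains.
Variables (k : comPzRingType) (G : groupType).
Local Notation kG := (group_ring k G).

Definition finite_valued (Y : free_action G) : {pred (Y -> k)} :=
  fun phi => `[< finite_set (range phi) >].

Lemma finite_valued_closed Y : zmod_closed (@finite_valued Y).
Proof.
split=> [|phi psi /asboolP fphi /asboolP fpsi]; apply/asboolP.
  by apply: (@sub_finite_set _ _ [set 0]%classic) => // _ [y _ <-].
apply: (@sub_finite_set _ _
  [set a - b | a in range phi & b in range psi]%classic); last exact: finite_image2.
by move=> _ [y _ <-]; exists (phi y); [exists y|exists (psi y); [exists y|]].
Qed.

HB.instance Definition _ (Y : free_action G) :=
  GRing.isZmodClosed.Build (Y -> k) (@finite_valued Y) (@finite_valued_closed Y).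

Record cochains (Y : free_action G) :=
  Cochains { cochain_val :> Y -> k; _ : cochain_val \in @finite_valued Y }.
HB.instance Definition _ (Y : free_action G) := [isSub for @cochain_val Y].
HB.instance Definition _ (Y : free_action G) := [Choice of cochains Y by <:].
HB.instance Definition _ (Y : free_action G) := [SubChoice_isSubZmodule of cochains Y by <:].

Definition mk_cochain (Y : free_action G) (phi : Y -> k) (fin : finite_set (range phi)) : cochains Y :=
  @Cochains Y phi (asboolT fin).

Lemma cochainP Y (phi psi : cochains Y) : (forall y, phi y = psi y) -> phi = psi.
Proof. by move=> eq_val; apply/val_inj/funext. Qed.

Lemma cochain_finite Y (phi : cochains Y) : finite_set (range phi).
Proof. by case: phi => phi fphi; exact: asboolW fphi. Qed.

Lemma coshift_subproof Y (x : G) (a : k) (phi : cochains Y) :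
  finite_set (range (fun y => a * phi (act x^-1%g y))).
Proof.
apply: (@sub_finite_set _ _ ((fun b => a * b) @` range phi)%classic).
  by move=> _ [y _ <-]; exists (phi (act x^-1%g y)) => //; exists (act x^-1%g y).
exact/finite_image/cochain_finite.
Qed.

Definition coshift Y x a (phi : cochains Y) : cochains Y :=
  mk_cochain (coshift_subproof x a phi).

Section CochainModule.
Variable Y : free_action G.
Implicit Types phi psi : cochains Y.

Lemma coshiftDl x a b phi : coshift x (a + b) phi = coshift x a phi + coshift x b phi.
Proof. by apply: cochainP => y; apply: mulrDl. Qed.

Lemma coshiftDr x a phi psi : coshift x a (phi + psi) = coshift x a phi + coshift x a psi.
Proof. by apply: cochainP => y; apply: mulrDr. Qed.

Lemma coshiftM x y a b phi :
  coshift x a (coshift y b phi) = coshift (x * y)%g (a * b) phi.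
Proof. by apply: cochainP => z /=; rewrite mulrA -actM invgM. Qed.

Lemma coshift1 phi : coshift 1%g 1 phi = phi.
Proof. by apply: cochainP => z /=; rewrite mul1r invg1 act1. Qed.

HB.instance Definition _ := GRing.Zmodule_isLmodule.Build kG (cochains Y)
  (monomial_scaleA coshiftDl coshiftDr coshiftM) (monomial_scale1 coshiftDl coshift1)
  (monomial_scaleDr coshiftDr) (monomial_scaleDl coshiftDl).

Lemma gmon_cochain x a phi y : (gmon x a *: phi) y = a * phi (act x^-1%g y).
Proof. by rewrite [_ *: _](monomial_scale_gmon coshiftDl). Qed.

Lemma cochains_function_module : function_module Y (cochains Y : lmodType kG).
Proof.
exists (fun phi : cochains Y => phi : Y -> k) => //.
- by move=> g c phi y; apply: gmon_cochain.
- exact: cochainP.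
- exact: cochain_finite.
move=> s P _.
have finP : finite_set (range (fun y : Y => (P y)%:R : k)).
  apply: (@sub_finite_set _ _ ((fun b : bool => b%:R) @` [set: bool])%classic).
    by move=> _ [y _ <-]; exists (P y).
  exact/finite_image/finite_finset.
by exists (mk_cochain finP).
Qed.
End CochainModule.

(** Evaluation of a cochain on a chain, through which the properties of the
coboundary are transposed from those of the boundary. *)
Definition pairing (Y : free_action G) (phi : Y -> k) : chains k Y -> k :=
  chain_lift (fun y => phi y \*o idfun).
HB.instance Definition _ Y phi := GRing.Additive.on (@pairing Y phi).

Lemma pairing_cell (Y : free_action G) (phi : Y -> k) y a :
  pairing phi (cell y a) = phi y * a.
Proof. exact: chain_lift_cell. Qed.

Lemma pairing0 (Y : free_action G) (phi : Y -> k) : pairing phi 0 = 0.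
Proof. exact: raddf0. Qed.

Lemma pairingD (Y : free_action G) (phi : Y -> k) c c' :
  pairing phi (c + c') = pairing phi c + pairing phi c'.
Proof. exact: raddfD. Qed.

Lemma pairingB (Y : free_action G) (phi : Y -> k) c c' :
  pairing phi (c - c') = pairing phi c - pairing phi c'.
Proof. exact: raddfB. Qed.

Lemma pairing_cone (Y : free_action G) (phi : cone_action Y -> k) x (c : chains k Y) :
  pairing phi (cone x c) = pairing (fun y => phi (x, y)) c.
Proof.
elim/chains_ind: c => [|c c' IHc IHc'|y a]; first by rewrite raddf0 !pairing0.
  by rewrite coneD !pairingD IHc IHc'.
by rewrite cone_cell !pairing_cell.
Qed.

Lemma pairing_shift (Y : free_action G) (phi : Y -> k) g b (c : chains k Y) :
  pairing phi (shift g b c) = b * pairing (fun y => phi (act g y)) c.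
Proof.
elim/chains_ind: c => [|c c' IHc IHc'|y a]; first by rewrite raddf0 !pairing0 mulr0.
  by rewrite shiftDr !pairingD mulrDr IHc IHc'.
by rewrite shift_cell !pairing_cell mulrCA.
Qed.

Lemma pairing_subl (Y : free_action G) (phi psi : Y -> k) c :
  pairing (fun y => phi y - psi y) c = pairing phi c - pairing psi c.
Proof.
elim/chains_ind: c => [|c c' IHc IHc'|y a]; first by rewrite !pairing0 subr0.
  by rewrite !pairingD IHc IHc' opprD addrACA.
by rewrite !pairing_cell mulrBl.
Qed.

Lemma pairing_scalel (Y : free_action G) (phi : Y -> k) b c :
  pairing (fun y => b * phi y) c = b * pairing phi c.
Proof.
elim/chains_ind: c => [|c c' IHc IHc'|y a]; first by rewrite !pairing0 mulr0.
  by rewrite !pairingD IHc IHc' mulrDr.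
by rewrite !pairing_cell mulrA.
Qed.

Local Notation K n := (cochains (bar G n)).

(** The coboundary at a cell is an alternating sum of [n + 2] values of [phi],
so it stays in a finite set that depends only on [n] and on the values of
[phi].  The uniformity in [phi] serves the induction, which passes to the
functions [phi (x, _)] for all [x] at once. *)
Lemma pairing_face_finite n (V : set k) : finite_set V ->
  exists2 W : set k, finite_set W &
    forall phi : bar G n -> k, (forall y, V (phi y)) ->
      forall p : bar G n.+1, W (pairing phi (face p 1)).
Proof.
move=> finV; elim: n => [|n [W finW VW]].
  exists [set a - b | a in V & b in V]%classic; first exact: finite_image2.
  move=> phi Vphi [x y]; rewrite face_bar0 pairingB !pairing_cell !mulr1.
  by exists (phi y) => //; exists (phi x).
exists [set a - b | a in V & b in W]%classic; first exact: finite_image2.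
move=> phi Vphi [x y]; rewrite face_cone pairingB pairing_cell mulr1 pairing_cone.
by exists (phi y) => //; exists (pairing (fun y => phi (x, y)) (face y 1)); first exact: VW.
Qed.

Lemma cobd_subproof n (phi : K n) :
  finite_set (range (fun p : bar G n.+1 => pairing phi (face p 1))).
Proof.
have [W finW VW] := pairing_face_finite n (cochain_finite phi).
by apply: sub_finite_set finW => _ [p _ <-]; apply: VW => y; exists y.
Qed.

Definition cobd n (phi : K n) : K n.+1 := mk_cochain (cobd_subproof phi).

Lemma cobdE n (phi : K n) p : cobd phi p = pairing phi (face p 1).
Proof. by []. Qed.

Lemma cobd_zmod_morphism n : zmod_morphism (@cobd n).
Proof. by move=> phi psi; apply: cochainP => p; apply: pairing_subl. Qed.

HB.instance Definition _ n :=
  GRing.isZmodMorphism.Build (K n) (K n.+1) (@cobd n) (@cobd_zmod_morphism n).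

Lemma cobd_gmon n g b (phi : K n) : cobd (gmon g b *: phi) = gmon g b *: cobd phi.
Proof.
apply: cochainP => p; rewrite gmon_cochain !cobdE.
have -> : (gmon g b *: phi : _ -> k) = (fun y => b * phi (act g^-1%g y)).
  by apply/funext => y; apply: gmon_cochain.
rewrite pairing_scalel; congr (_ * _).
by rewrite -[in RHS](mulr1 1) face_act pairing_shift mul1r.
Qed.

Lemma pairing_bd n (phi : K n) c : pairing phi (bd c) = pairing (cobd phi) c.
Proof.
elim/chains_ind: c => [|c c' IHc IHc'|p a]; first by rewrite bd0 !pairing0.
  by rewrite bdD !pairingD IHc IHc'.
rewrite bd_cell pairing_cell cobdE -[in LHS](act1 p) -[in LHS](mulr1 a) face_act.
rewrite pairing_shift mulrC; congr (pairing _ _ * _).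
by apply/funext => y; rewrite act1.
Qed.

Lemma cobd_cobd n (phi : K n) : cobd (cobd phi) = 0.
Proof.
by apply: cochainP => p; rewrite cobdE -pairing_bd bd_face pairing0.
Qed.

Lemma cosection_subproof Y (phi : cochains (cone_action Y)) :
  finite_set (range (fun y => phi (1%g, y))).
Proof.
by apply: sub_finite_set (cochain_finite phi) => _ [y _ <-]; exists (1%g, y).
Qed.

(** Evaluation of the first coordinate at 1, dual to the cone with apex 1. *)
Definition cosection Y (phi : cochains (cone_action Y)) : cochains Y :=
  mk_cochain (cosection_subproof phi).

Lemma cosection_zmod_morphism Y : zmod_morphism (@cosection Y).
Proof. by move=> phi psi; apply: cochainP. Qed.

HB.instance Definition _ (Y : free_action G) := GRing.isZmodMorphism.Build
  (cochains (cone_action Y)) (cochains Y) (@cosection Y) (@cosection_zmod_morphism Y).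

Lemma cosection_cobd n (phi : K n.+1) :
  cosection (cobd phi : cochains (cone_action (bar G n.+1))) = phi - cobd (cosection phi).
Proof.
apply: cochainP => y.
rewrite -[LHS]/(pairing phi (face ((1%g, y) : bar G n.+2) 1)).
by rewrite face_cone pairingB pairing_cell mulr1 pairing_cone.
Qed.

Lemma const_subproof (a : k) : finite_set (range (fun _ : bar G 0 => a)).
Proof. by apply: (@sub_finite_set _ _ [set a]%classic) => // _ [y _ <-]. Qed.

Definition constant (a : trivial_module k G) : K 0 := mk_cochain (const_subproof a).

Lemma constant_linear : linear constant.
Proof.
move=> r a b; apply: cochainP => y.
rewrite -[RHS]/((r *: constant a) y + b) -[LHS]/(augmentation r * a + b).
congr (_ + _); elim/group_ring_ind: r => [|r s IHr IHs|x c].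
- by rewrite raddf0 mul0r scale0r.
- by rewrite raddfD mulrDl IHr IHs scalerDl.
by rewrite augmentation_gmon gmon_cochain.
Qed.
HB.instance Definition _ := GRing.isLinear.Build kG (trivial_module k G) (K 0)
  *:%R constant constant_linear.

Lemma cobd_constant a : cobd (constant a) = 0.
Proof.
apply: cochainP => -[x y].
by rewrite cobdE face_bar0 pairingB !pairing_cell subrr.
Qed.

Lemma cobd0_eq0 (phi : K 0) : cobd phi = 0 -> phi = constant (phi (1%g : bar G 0)).
Proof.
move=> phi0; apply: cochainP => y.
have := congr1 (fun psi : K 1 => psi (1%g, y)) phi0.
by rewrite cobdE face_bar0 pairingB !pairing_cell !mulr1 => /eqP; rewrite subr_eq0 => /eqP.
Qed.
End Cochains.

(** * The complete flat resolution of the trivial module *)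

Section CompleteResolution.
Variables (k : comPzRingType) (G : groupType).
Local Notation kG := (group_ring k G).
Local Notation C n := (chains k (bar G n)).
Local Notation K n := (cochains k (bar G n)).

(** The composite of the augmentation onto [k] and of the inclusion of [k] as
the constant functions. *)
Definition splice (c : C 0) : K 0 := constant (aug c).

Lemma splice_zmod_morphism : zmod_morphism splice.
Proof. by move=> c c'; rewrite /splice !raddfB. Qed.
HB.instance Definition _ := GRing.isZmodMorphism.Build (C 0) (K 0) splice
  splice_zmod_morphism.

Lemma splice_gmon x a c : splice (gmon x a *: c) = gmon x a *: splice c.
Proof.
apply: cochainP => y; rewrite gmon_cochain gmon_chain -[LHS]/(aug (shift x a c)).
exact: aug_shift.
Qed.

HB.instance Definition _ n := GRing.isLinear.Build kG (C n.+1) (C n) *:%R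
  (@bd k G n) (linear_of_gmon (@bd_gmon k G n)).
HB.instance Definition _ n := GRing.isLinear.Build kG (K n) (K n.+1) *:%R
  (@cobd k G n) (linear_of_gmon (@cobd_gmon k G n)).
HB.instance Definition _ := GRing.isLinear.Build kG (C 0) (K 0) *:%R
  splice (linear_of_gmon splice_gmon).

Definition bar_term (i : int) : lmodType kG :=
  match i with Posz n => C n | Negz n => K n end.

(** The types match by computation.  The sum [1 + Negz n.+2] reduces to
[Negz n.+1], while [1 + Negz n.+1] is stuck for a variable [n], whence the
separate case of [Negz 1]. *)
Definition bar_diff (i : int) : {linear bar_term (1 + i) -> bar_term i} :=
  match i return {linear bar_term (1 + i) -> bar_term i} with
  | Posz n => (@bd k G n : {linear C n.+1 -> C n})
  | Negz 0 => (splice : {linear C 0 -> K 0})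
  | Negz 1 => (@cobd k G 0 : {linear K 0 -> K 1})
  | Negz n.+2 => (@cobd k G n.+1 : {linear K n.+1 -> K n.+2})
  end.

Definition cosplice (phi : K 0) : C 0 := cell (1%g : bar G 0) (phi (1%g : bar G 0)).

Lemma cosplice_zmod_morphism : zmod_morphism cosplice.
Proof. by move=> phi psi; rewrite /cosplice -(raddfB (cell _)). Qed.
HB.instance Definition _ := GRing.isZmodMorphism.Build (K 0) (C 0) cosplice
  cosplice_zmod_morphism.

(** A [k]-linear contracting homotopy; it is not equivariant, since it singles
out the element 1 of [G]. *)
Definition contraction (i : int) : {additive bar_term i -> bar_term (1 + i)} :=
  match i return {additive bar_term i -> bar_term (1 + i)} with
  | Posz n => (@cone k G (bar G n) 1%g : {additive C n -> C n.+1})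
  | Negz 0 => (cosplice : {additive K 0 -> C 0})
  | Negz 1 => (@cosection k G (bar G 0) : {additive K 1 -> K 0})
  | Negz n.+2 => (@cosection k G (bar G n.+1) : {additive K n.+2 -> K n.+1})
  end.

Lemma bar_diffK i x : bar_diff i (bar_diff (1 + i) x) = 0.
Proof.
case: i x => [n|[|[|[|n]]]] x.
- exact: bd_bd.
- by rewrite -[LHS]/(constant (aug (bd (x : C 1)))) aug_bd raddf0.
- exact: cobd_constant.
- exact: cobd_cobd.
exact: cobd_cobd.
Qed.

Definition bar_complex : complex kG := Complex bar_diffK.

Lemma bd_homotopy n (c : C n.+1) :
  bd (cone 1%g c : C n.+2) + cone 1%g (bd c) = c.
Proof. by rewrite bd_cone subrK. Qed.

Lemma splice_homotopyl (c : C 0) : bd (cone 1%g c : C 1) + cosplice (splice c) = c.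
Proof. by rewrite bd_cone0 subrK. Qed.

Lemma splice_homotopyr (phi : K 0) :
  splice (cosplice phi) + cosection (cobd phi) = phi.
Proof.
apply: cochainP => y.
rewrite -[LHS]/(aug (cosplice phi) + cobd phi ((1%g, y) : bar G 1)).
by rewrite aug_cell cobdE face_bar0 pairingB !pairing_cell !mulr1 addrC subrK.
Qed.

Lemma cobd_homotopy n (phi : K n.+1) :
  cobd (cosection phi : K n) + cosection (cobd phi) = phi.
Proof. by rewrite cosection_cobd addrC subrK. Qed.

Lemma contraction_homotopy i x :
  bar_diff (1 + i) (contraction (1 + i) x) + contraction i (bar_diff i x) = x.
Proof.
case: i x => [n|[|[|[|n]]]] x.
- exact: bd_homotopy.
- exact: splice_homotopyl.
- exact: splice_homotopyr.
- exact: (@cobd_homotopy 0).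
exact: cobd_homotopy.
Qed.

Lemma cosection_scalars n : commutes_with_scalars (@cosection k G (bar G n) : K n.+1 -> K n).
Proof.
move=> c phi; apply: cochainP => y; rewrite gmon_cochain invg1 act1.
rewrite -[LHS]/((gmon 1%g c *: phi) ((1%g, y) : bar G n.+1)) gmon_cochain invg1.
by rewrite act1.
Qed.

Lemma contraction_scalars i : commutes_with_scalars (contraction i).
Proof.
case: i => [n|[|[|n]]] c x.
- rewrite -[LHS]/(cone 1%g (gmon 1%g c *: (x : C n))).
  rewrite -[RHS]/(gmon 1%g c *: (cone 1%g (x : C n) : C n.+1)).
  by rewrite !gmon_chain shift_cone mulg1.
- rewrite -[LHS]/(cell (1%g : bar G 0) ((gmon 1%g c *: (x : K 0)) (1%g : bar G 0))).
  rewrite -[RHS]/(gmon 1%g c *: cosplice (x : K 0)).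
  by rewrite gmon_cochain gmon_chain shift_cell act1 invg1 act1.
- exact: cosection_scalars.
exact: cosection_scalars.
Qed.

Lemma bar_complete_flat_resolution :
  locally_finite G -> complete_flat_resolution bar_complex.
Proof.
move=> lfG; split=> [i|i x|I injI i].
- case: i => n; first exact: function_module_flat (chains_function_module _ _) lfG.
  exact: function_module_flat (cochains_function_module _ _) lfG.
- split=> [dx0|[y <-]]; last exact: diffK.
  exists (contraction (1 + i) x).
  by rewrite -[RHS](contraction_homotopy x) dx0 raddf0 addr0.
exact: contraction_tensor_exact lfG injI (@bar_diffK i)
  (@contraction_scalars _) (@contraction_scalars _) (@contraction_homotopy i).
Qed.

(** The kernel of the coboundary on 0-cochains consists of the constant
functions; this differential has index -2, which is [Negz 1]. *)
Lemma trivial_syzygy : syzygy bar_complex (trivial_module k G : lmodType kG).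
Proof.
exists (Negz 1), (@constant k G : {linear _ -> _}); split.
  by move=> a b /(congr1 (fun phi : K 0 => phi (1%g : bar G 0))).
move=> phi; split=> [phi0|[a <-]]; last exact: cobd_constant.
by exists ((phi : K 0) (1%g : bar G 0)); apply/esym/cobd0_eq0.
Qed.

Lemma trivial_Gorenstein_flat :
  locally_finite G -> Gorenstein_flat (trivial_module k G : lmodType kG).
Proof.
by move=> lfG; exists bar_complex; split;
  [apply: bar_complete_flat_resolution|apply: trivial_syzygy].
Qed.

End CompleteResolution.

(** * Gorenstein flat dimension zero *)

Section GorensteinFlatDimensionZero.
Variable R : pzRingType.

Definition zero_module : lmodType R := {ffun 'I_0 -> R^o}.

Lemma zero_moduleP (x : zero_module) : x = 0.
Proof. by apply/ffunP => -[]. Qed.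

Lemma tensor_zero_module (A : lmodType R^c) (t : tensor A zero_module) : t = 0.
Proof.
have [u ->] := tensor_fsum t; rewrite -(fsum0 (tensor A zero_module) u).
by apply: eq_fsum => a m; rewrite (zero_moduleP m) raddf0.
Qed.

Definition zero_complex : complex R :=
  @Complex R (fun=> zero_module) (fun=> (\0 : {linear zero_module -> zero_module}))
    (fun _ _ => erefl).

Lemma zero_module_Gorenstein_flat : Gorenstein_flat zero_module.
Proof.
exists zero_complex; split; last first.
  exists 0, (idfun : {linear zero_module -> zero_module}); split=> // x.
  by split=> // _; exists x.
split=> [i A B f _ t t' _|i x|I _ i t].
- by rewrite [t]tensor_zero_module [t']tensor_zero_module.
- by split=> _; [exists 0; rewrite [x]zero_moduleP|apply: zero_moduleP].
by split=> _; [exists 0; rewrite [t]tensor_zero_module|]; apply: tensor_zero_module.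
Qed.

Lemma Gfd_eq0 (M : lmodType R) : Gfd M = Some 0%N <-> Gorenstein_flat_resolution M 0.
Proof.
rewrite /Gfd; case: pselect => [ex|nex]; last first.
  by split=> // M0; case: nex; exists 0%N; apply/asboolP.
case: ex_minnP => n /asboolP Mn n_min; split=> [[n0]|/asboolP/n_min].
  by rewrite -n0.
by rewrite leqn0 => /eqP ->.
Qed.

Lemma Gorenstein_flat_Gfd (M : lmodType R) : Gorenstein_flat M -> Gfd M = Some 0%N.
Proof.
move=> GM; apply/Gfd_eq0.
pose P (i : nat) : lmodType R := if i is 0 then M else zero_module.
exists P, (fun i => (\0 : {linear P i.+1 -> P i})), (idfun : {linear M -> M}).
split=> [[|i]|[|i] //|y|y|i y] //.
- exact: zero_module_Gorenstein_flat.
- by move=> _ x; apply: zero_moduleP.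
- by exists y.
- by split=> [/= ->|[x <-]] //; exists 0.
by split=> _; [exists 0; rewrite [y]zero_moduleP|].
Qed.
End GorensteinFlatDimensionZero.

(** A resolution of length 0 is an isomorphism [e] from a Gorenstein flat [P],
and a syzygy of a complex of flat modules embeds in one of them. *)
Lemma Gfd_eq0_embedding (R : pzRingType) (M : lmodType R) :
  Gfd M = Some 0%N ->
  exists (P F : lmodType R) (e : {linear P -> M}) (f : {linear P -> F}),
    [/\ injective e, (forall y, exists x, e x = y), injective f & flat F].
Proof.
move=> /Gfd_eq0[P [d [e [GP P0 surj_e ex_e _]]]].
have [F [[flatF _ _] [i [f [inj_f _]]]]] := GP 0%N.
exists (P 0%N), (F (1 + i)), e, f; split=> // x x' /eqP.
rewrite -subr_eq0 -raddfB => /eqP/ex_e[z dz]; apply/eqP; rewrite -subr_eq0.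
by rewrite -dz (P0 1%N isT z) raddf0.
Qed.

Theorem theorem1p4 (G : groupType) :
  [<-> locally_finite G;
       forall k : comPzRingType, Ghd k G = Some 0%N;
       Ghd int G = Some 0%N].
Proof.
tfae=> [lfG k|GhdG|Ghd0]; first exact/Gorenstein_flat_Gfd/trivial_Gorenstein_flat.
  exact: GhdG.
have [P [F [e [f [inj_e surj_e inj_f flatF]]]]] := Gfd_eq0_embedding Ghd0.
pose one : trivial_module int G := 1.
have [p ep] := surj_e one.
apply: (@fixed_vector_locally_finite int G F (f p)) => //.
  move=> fp0; have: e p = 0 by rewrite (inj_f p 0) ?raddf0.
  by rewrite ep.
move=> x; rewrite -linearZ; congr (f _); apply: inj_e.
rewrite linearZ ep -[LHS]/(augmentation (gmon x (1 : int)) * 1).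
by rewrite augmentation_gmon.
Qed.
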